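(* Let $q\geq 2$ and $2\le r\le q$. Then there is a homotopy equivalence \[B(r,Q_{2^{q+1}})\simeq B\left(\Big(\ast_{\mu_{2^{r-1}}}^{2^{q+1-r}}Q_{2^{r}}\Big) *_{\mu_{2^{r-1}}} \mu_{2^{q}}\right),\] where the group on the right is the amalgamated product, along the common subgroup $\mu_{2^{r-1}}$, of $2^{q+1-r}$ copies of $Q_{2^r}$ and one copy of $\mu_{2^q}$.
   Context: $F_n$ is the free group on $n$ generators; the descending central series of a group $Q$ is $\Gamma^1(Q)=Q$, $\Gamma^{k+1}(Q)=[\Gamma^k(Q),Q]$, and $\Gamma^k_n:=\Gamma^k(F_n)$. For a topological group $G$ and $r\ge 2$, the spaces $\mathrm{Hom}(F_n/\Gamma^r_n,G)\subset G^n$ form a simplicial subspace of the nerve of $G$, and $B(r,G):=|\mathrm{Hom}(F_*/\Gamma^r_*,G)|$ is its geometric realization. Let $\mu_{m}$ be the cyclic subgroup of $SU(2)$ of order $m$ generated by $\begin{pmatrix} e^{2\pi i/m}&0\\0&e^{-2\pi i/m}\end{pmatrix}$ and let $w=\begin{pmatrix}0&-1\\1&0\end{pmatrix}$. For $s\ge 2$, $Q_{2^{s}}=\mu_{2^{s-1}}\cup w\mu_{2^{s-1}}\subset SU(2)$, a discrete group of order $2^s$ (so $Q_4\cong\mathbb{Z}/4$). The group $\mu_{2^{r-1}}$ is included in $Q_{2^r}$ and in $\mu_{2^q}$ as a subgroup of $SU(2)$. *)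

(* Defs.v *)
From HB Require Import structures.
From mathcomp Require Import all_boot all_order all_algebra monoid.
From mathcomp Require Import generic_quotient spectral complex.
From mathcomp Require Import mathcomp_extra boolp classical_sets functions reals topology trigo.

Set Implicit Arguments.
Unset Strict Implicit.
Unset Printing Implicit Defensive.

Import Order.TTheory GRing.Theory Num.Theory numFieldTopology.Exports.

Notation group_hom := UMagmaMorphism.type.

Section Generated.
Local Open Scope group_scope.
Variable G : groupType.

Inductive generated_prop (A : set G) : G -> Prop :=
| generated_in x : A x -> generated_prop A x
| generated_1 : generated_prop A 1
| generated_M x y :
    generated_prop A x -> generated_prop A y -> generated_prop A (x * y)
| generated_V x : generated_prop A x -> generated_prop A x^-1.

(* The subgroup generated by A. *)
Definition generated (A : set G) : {pred G} := fun x => `[< generated_prop A x >].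

Lemma generatedP A x : reflect (generated_prop A x) (x \in generated A).
Proof. exact: asboolP. Qed.

Lemma mem_generated A x : A x -> x \in generated A.
Proof. by move=> Ax; apply/generatedP; apply: generated_in. Qed.

Lemma generated_mulM A : mulg_closed (generated A).
Proof.
by move=> x y /generatedP Ax /generatedP Ay; apply/generatedP; apply: generated_M.
Qed.

Lemma generated_invr A : invg_closed (generated A).
Proof. by move=> x /generatedP Ax; apply/generatedP; apply: generated_V. Qed.

Lemma generated_mem1 A : 1 \in generated A.
Proof. by apply/generatedP; apply: generated_1. Qed.

HB.instance Definition _ A := isMulClosed.Build G (generated A) (@generated_mulM A).
HB.instance Definition _ A := isMul1Closed.Build G (generated A) (generated_mem1 A).
HB.instance Definition _ A := isInvClosed.Build G (generated A) (@generated_invr A).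

Lemma generated_sub (A : set G) (S : groupClosed G) :
  (forall x, A x -> x \in S) -> {subset generated A <= S}.
Proof.
move=> AS x /generatedP; elim=> {x} [x /AS//||x y _ xS _ yS|x _ xS].
- exact: gpred1.
- exact: gpredM.
- exact: gpredVr.
Qed.

End Generated.

HB.mixin Record isNormalPred (G : groupType) (S : {pred G}) := {
  gpredJ_normal : forall x y, x \in S -> (x ^ y)%g \in S
}.

(* Normal subgroups. *)
#[short(type="normalClosed")]
HB.structure Definition NormalClosed (G : groupType) :=
  {S of isNormalPred G S & GroupClosed G S}.

Section Normal.
Local Open Scope group_scope.

Lemma generated_normal (G : groupType) (A : set G) :
  (forall x y, A x -> A (x ^ y)) ->
  forall x y, x \in generated A -> x ^ y \in generated A.
Proof.
move=> AJ x y /generatedP; elim=> {x} [x Ax||x z _ xA _ zA|x _ xA].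
- by apply/mem_generated/AJ.
- by rewrite conj1g gpred1.
- by rewrite conjMg gpredM.
- by rewrite conjVg gpredVr.
Qed.

Definition normal_closure (G : groupType) (A : set G) : {pred G} :=
  generated [set u | exists x y, A x /\ u = x ^ y].

Section NormalClosure.
Variables (G : groupType) (A : set G).

HB.instance Definition _ := GroupClosed.on (normal_closure A).

Lemma normal_closureJ x y : x \in normal_closure A -> x ^ y \in normal_closure A.
Proof.
apply: generated_normal => {}x {}y [u [v [Au ->]]].
by exists u, (v * y); rewrite conjgM.
Qed.
HB.instance Definition _ := isNormalPred.Build G (normal_closure A) normal_closureJ.

Lemma mem_normal_closure x : A x -> x \in normal_closure A.
Proof. by move=> Ax; apply: mem_generated; exists x, 1; rewrite conjg1. Qed.
End NormalClosure.

End Normal.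

Section QuotientGroup.
Local Open Scope group_scope.
Local Open Scope quotient_scope.
Variables (G : groupType) (N : normalClosed G).

Definition coset_rel : rel G := fun x y => x^-1 * y \in N.

Lemma coset_refl : reflexive coset_rel.
Proof. by move=> x; rewrite /coset_rel mulVg gpred1. Qed.
Lemma coset_sym : symmetric coset_rel.
Proof. by move=> x y; rewrite /coset_rel -gpredV invgM invgK. Qed.
Lemma coset_trans : transitive coset_rel.
Proof.
move=> y x z xy yz; rewrite /coset_rel.
by rewrite -(mulgK y x^-1) -mulgA gpredM.
Qed.

Definition coset_equiv := EquivRel coset_rel coset_refl coset_sym coset_trans.

Definition quotient_group := {eq_quot coset_equiv}.
HB.instance Definition _ := Choice.on quotient_group.
HB.instance Definition _ := EqQuotient.on quotient_group.

Definition coset (x : G) : quotient_group := \pi_quotient_group x.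

Lemma coset_eqP x y : reflect (coset x = coset y) (x^-1 * y \in N).
Proof. exact: (eqquotP quotient_group x y). Qed.

Lemma cosetW (P : quotient_group -> Prop) : (forall x, P (coset x)) -> forall u, P u.
Proof. by move=> H u; rewrite -(reprK u). Qed.

Definition quot_one : quotient_group := coset 1.
Definition quot_inv (u : quotient_group) : quotient_group := coset (repr u)^-1.
Definition quot_mul (u v : quotient_group) : quotient_group :=
  coset (repr u * repr v).

Lemma repr_coset x : (repr (coset x))^-1 * x \in N.
Proof. by apply/coset_eqP; rewrite /coset reprK. Qed.

Lemma quot_mulE x y : quot_mul (coset x) (coset y) = coset (x * y).
Proof.
apply/coset_eqP; rewrite invgM.
have hx := repr_coset x; have hy := repr_coset y.
set a := repr _ in hx *; set b := repr _ in hy *.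
have -> : b^-1 * a^-1 * (x * y) = (b^-1 * y) * (a^-1 * x) ^ y.
  by rewrite /conjg !mulgA mulgK.
by rewrite gpredM// gpredJ_normal.
Qed.

Lemma quot_invE x : quot_inv (coset x) = coset x^-1.
Proof.
apply/coset_eqP; rewrite invgK.
have hx := repr_coset x; set a := repr _ in hx *.
have -> : a * x^-1 = ((a^-1 * x)^-1) ^ a^-1.
  by rewrite /conjg invgM !invgK !mulgA mulgK.
by rewrite gpredJ_normal// gpredV.
Qed.

Lemma quot_mulA : associative quot_mul.
Proof.
by elim/cosetW=> x; elim/cosetW=> y; elim/cosetW=> z; rewrite !quot_mulE mulgA.
Qed.
Lemma quot_mul1g : left_id quot_one quot_mul.
Proof. by elim/cosetW=> x; rewrite quot_mulE mul1g. Qed.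
Lemma quot_mulg1 : right_id quot_one quot_mul.
Proof. by elim/cosetW=> x; rewrite quot_mulE mulg1. Qed.
Lemma quot_mulVg : left_inverse quot_one quot_inv quot_mul.
Proof. by elim/cosetW=> x; rewrite quot_invE quot_mulE mulVg. Qed.
Lemma quot_mulgV : right_inverse quot_one quot_inv quot_mul.
Proof. by elim/cosetW=> x; rewrite quot_invE quot_mulE mulgV. Qed.

HB.instance Definition _ := isGroup.Build quotient_group
  quot_mulA quot_mul1g quot_mulg1 quot_mulVg quot_mulgV.

Lemma cosetM : {morph coset : x y / x * y}.
Proof. by move=> x y; rewrite -quot_mulE. Qed.
Lemma coset1 : coset 1 = 1.
Proof. by []. Qed.
HB.instance Definition _ :=
  isUMagmaMorphism.Build G quotient_group coset (coset1, cosetM).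

Section Lift.
Variables (H : groupType) (f : group_hom G H).
Hypothesis fN : forall x, x \in N -> f x = 1.

Definition quot_lift (u : quotient_group) : H := f (repr u).

Lemma quot_liftE x : quot_lift (coset x) = f x.
Proof.
have /fN := repr_coset x; rewrite gmulfM gmulfV => h.
by rewrite /quot_lift -[LHS]mulg1 -h mulgA mulgV mul1g.
Qed.

Lemma quot_lift_morph : monoid.monoid_morphism quot_lift.
Proof.
split=> [|]; first by rewrite -coset1 quot_liftE gmulf1.
by elim/cosetW=> x; elim/cosetW=> y; rewrite -cosetM !quot_liftE gmulfM.
Qed.

Definition quot_lift_hom : group_hom quotient_group H :=
  HB.pack quot_lift
    (isUMagmaMorphism.Build quotient_group H quot_lift quot_lift_morph).
End Lift.

End QuotientGroup.

Section FreeGroup.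
Local Open Scope group_scope.
Local Open Scope quotient_scope.
Variable X : choiceType.

(* The letter (x, false) stands for x and (x, true) for the inverse of x. *)
Notation word := (seq (X * bool)).

Inductive free_eqv : word -> word -> Prop :=
| free_refl w : free_eqv w w
| free_sym v w : free_eqv v w -> free_eqv w v
| free_trans u v w : free_eqv u v -> free_eqv v w -> free_eqv u w
| free_cancel u v x b : free_eqv (u ++ [:: (x, b), (x, ~~ b) & v]) (u ++ v).

Definition free_rel : rel word := fun v w => `[< free_eqv v w >].

Lemma free_rel_refl : reflexive free_rel.
Proof. by move=> w; apply/asboolP; apply: free_refl. Qed.
Lemma free_rel_sym : symmetric free_rel.
Proof. by move=> v w; apply/asboolP/asboolP; apply: free_sym. Qed.
Lemma free_rel_trans : transitive free_rel.
Proof.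
by move=> v u w /asboolP uv /asboolP vw; apply/asboolP; apply: free_trans uv vw.
Qed.

Definition free_equiv := EquivRel free_rel free_rel_refl free_rel_sym free_rel_trans.

Definition free_group := {eq_quot free_equiv}.
HB.instance Definition _ := Choice.on free_group.
HB.instance Definition _ := EqQuotient.on free_group.

Definition free_class (w : word) : free_group := \pi_free_group w.

Lemma free_classP v w : free_class v = free_class w <-> free_eqv v w.
Proof.
split=> [/(eqquotP free_group v w)/asboolP//|h].
by apply/(eqquotP free_group v w)/asboolP.
Qed.

Lemma free_classW (P : free_group -> Prop) :
  (forall w, P (free_class w)) -> forall u, P u.
Proof. by move=> H u; rewrite -(reprK u). Qed.

Lemma free_repr w : free_eqv (repr (free_class w)) w.
Proof. by apply/free_classP; rewrite /free_class reprK. Qed.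

Definition word_inv (w : word) : word := rev [seq (l.1, ~~ l.2) | l <- w].

Lemma free_eqv_cat u u' v v' :
  free_eqv u u' -> free_eqv v v' -> free_eqv (u ++ v) (u' ++ v').
Proof.
move=> uu' vv'; apply: (@free_trans _ (u' ++ v)).
- elim: uu' => {u u'} [w|a b _ h|a b c _ h1 _ h2|a b x c].
  + exact: free_refl.
  + exact: free_sym.
  + exact: free_trans h1 h2.
  + by rewrite -!catA /=; apply: free_cancel.
- elim: vv' => {v v'} [w|a b _ h|a b c _ h1 _ h2|a b x c].
  + exact: free_refl.
  + exact: free_sym.
  + exact: free_trans h1 h2.
  + by rewrite !catA; apply: free_cancel.
Qed.

Lemma free_eqv_inv u v : free_eqv u v -> free_eqv (word_inv u) (word_inv v).
Proof.
elim=> {u v} [w|a b _ h|a b c _ h1 _ h2|a b x c].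
- exact: free_refl.
- exact: free_sym.
- exact: free_trans h1 h2.
- rewrite /word_inv !map_cat !rev_cat /= !rev_cons -!cats1 -!catA /= negbK.
  exact: free_cancel.
Qed.

Lemma word_invK : involutive word_inv.
Proof.
move=> w; rewrite /word_inv map_rev revK -map_comp -[RHS]map_id.
by apply: eq_map => -[x b] /=; rewrite negbK.
Qed.

Lemma free_eqv_mulV w : free_eqv (w ++ word_inv w) [::].
Proof.
elim/last_ind: w => [|w [x b] IH]; first exact: free_refl.
rewrite /word_inv map_rcons rev_rcons cat_rcons /=.
by apply: free_trans IH; apply: free_cancel.
Qed.

Lemma free_eqv_Vmul w : free_eqv (word_inv w ++ w) [::].
Proof. by rewrite -{2}[w]word_invK; apply: free_eqv_mulV. Qed.

Definition free_one : free_group := free_class [::].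
Definition free_inv (u : free_group) : free_group := free_class (word_inv (repr u)).
Definition free_mul (u v : free_group) : free_group := free_class (repr u ++ repr v).

Lemma free_mulE v w : free_mul (free_class v) (free_class w) = free_class (v ++ w).
Proof. by apply/free_classP; apply: free_eqv_cat; apply: free_repr. Qed.
Lemma free_invE w : free_inv (free_class w) = free_class (word_inv w).
Proof. by apply/free_classP; apply: free_eqv_inv; apply: free_repr. Qed.

Lemma free_mulA : associative free_mul.
Proof.
by elim/free_classW=> a; elim/free_classW=> b; elim/free_classW=> c;
  rewrite !free_mulE catA.
Qed.
Lemma free_mul1g : left_id free_one free_mul.
Proof. by elim/free_classW=> a; rewrite free_mulE. Qed.
Lemma free_mulg1 : right_id free_one free_mul.
Proof. by elim/free_classW=> a; rewrite free_mulE cats0. Qed.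
Lemma free_mulVg : left_inverse free_one free_inv free_mul.
Proof.
by elim/free_classW=> a; rewrite free_invE free_mulE; apply/free_classP/free_eqv_Vmul.
Qed.
Lemma free_mulgV : right_inverse free_one free_inv free_mul.
Proof.
by elim/free_classW=> a; rewrite free_invE free_mulE; apply/free_classP/free_eqv_mulV.
Qed.

HB.instance Definition _ := isGroup.Build free_group
  free_mulA free_mul1g free_mulg1 free_mulVg free_mulgV.

Definition free_gen (x : X) : free_group := free_class [:: (x, false)].

Section Lift.
Variables (G : groupType) (f : X -> G).

Definition word_eval (w : word) : G :=
  \prod_(l <- w) (if l.2 then (f l.1)^-1 else f l.1).

Lemma word_eval_eqv v w : free_eqv v w -> word_eval v = word_eval w.
Proof.
elim=> {v w} [//|v w _ ->//|u v w _ -> _ ->//|u v x b].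
rewrite /word_eval !big_cat !big_cons /=; congr (_ * _).
by case: b; rewrite /= ?mulKg ?mulVKg.
Qed.

Definition free_lift (u : free_group) : G := word_eval (repr u).

Lemma free_liftE w : free_lift (free_class w) = word_eval w.
Proof. exact/word_eval_eqv/free_repr. Qed.

Lemma free_lift_morph : monoid.monoid_morphism free_lift.
Proof.
split=> [|]; first by rewrite [1]/(free_class [::]) free_liftE /word_eval big_nil.
elim/free_classW=> a; elim/free_classW=> b.
by rewrite [_ * _]free_mulE !free_liftE /word_eval big_cat.
Qed.

Definition free_lift_hom : group_hom free_group G :=
  HB.pack free_lift
    (isUMagmaMorphism.Build free_group G free_lift free_lift_morph).

Lemma free_lift_gen x : free_lift_hom (free_gen x) = f x.
Proof. by rewrite /= free_liftE /word_eval big_seq1. Qed.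
End Lift.

End FreeGroup.

Section LowerCentral.
Local Open Scope group_scope.

Definition commutator_subgroup (G : groupType) (H K : {pred G}) : {pred G} :=
  generated [set u | exists x y, [/\ x \in H, y \in K & u = [~ x, y]]].

(* [lower_central G k] is the k-th term of the descending central series, with *)
(* the series starting at k = 1; the value at k = 0 is irrelevant.             *)
Definition lower_central (G : groupType) (k : nat) : {pred G} :=
  iter k.-1 (fun H : {pred G} => commutator_subgroup H predT) predT.
#[global] Arguments lower_central : clear implicits.
Section Instances.
Variable G : groupType.

Lemma lower_central_case k (P : {pred G} -> Prop) : P predT ->
  (forall j, P (commutator_subgroup (lower_central G j.+1) predT)) ->
  P (lower_central G k).
Proof. by move=> PT PS; rewrite /lower_central; case: k.-1 => [//|j] /=; apply: PS. Qed.

Lemma lower_centralS k : 0 < k ->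
  lower_central G k.+1 = commutator_subgroup (lower_central G k) predT.
Proof. by case: k. Qed.

Lemma lower_central_mulM k : mulg_closed (lower_central G k).
Proof.
by apply: (@lower_central_case k (fun S => mulg_closed S)) => // j;
  apply: generated_mulM.
Qed.
Lemma lower_central_invr k : invg_closed (lower_central G k).
Proof.
by apply: (@lower_central_case k (fun S => invg_closed S)) => // j;
  apply: generated_invr.
Qed.
Lemma lower_central_mem1 k : 1 \in lower_central G k.
Proof.
by apply: (@lower_central_case k (fun S => 1 \in S)) => // j; apply: generated_mem1.
Qed.

Lemma lower_centralJ k x y : x \in lower_central G k -> x ^ y \in lower_central G k.
Proof.
suff H j : forall x y, x \in lower_central G j.+1 -> x ^ y \in lower_central G j.+1.
  by case: k => [//|k]; apply: H.
elim: j => {x y} [//|j IH] x y.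
rewrite lower_centralS//; apply: generated_normal => u v [a [b [aj _ ->]]].
by exists (a ^ v), (b ^ v); rewrite conjRg; split=> //; apply: IH.
Qed.

HB.instance Definition _ k :=
  isMulClosed.Build G (lower_central G k) (@lower_central_mulM k).
HB.instance Definition _ k :=
  isMul1Closed.Build G (lower_central G k) (lower_central_mem1 k).
HB.instance Definition _ k :=
  isInvClosed.Build G (lower_central G k) (@lower_central_invr k).
HB.instance Definition _ k :=
  isNormalPred.Build G (lower_central G k) (@lower_centralJ k).
End Instances.

Lemma lower_central_hom (G H : groupType) (f : group_hom G H) k x :
  x \in lower_central G k -> f x \in lower_central H k.
Proof.
suff P j : forall x, x \in lower_central G j.+1 -> f x \in lower_central H j.+1.
  by case: k => [//|k]; apply: P.
elim: j => {x} [//|j IH] x; rewrite !(@lower_centralS _ j.+1)// => /generatedP.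
elim=> {x} [x [a [b [aj _ ->]]]||x y _ hx _ hy|x _ hx].
- by rewrite gmulfR; apply: mem_generated; exists (f a), (f b); split=> //; apply: IH.
- by rewrite gmulf1; apply: generated_mem1.
- by rewrite gmulfM; apply: generated_mulM.
- by rewrite gmulfV; apply: generated_invr.
Qed.

End LowerCentral.

(* F_n / Gamma^r_n and the images of the n free generators in it. *)
Definition free_nilpotent (n r : nat) : groupType :=
  quotient_group (lower_central (free_group 'I_n) r).

Definition free_nilpotent_gen (n r : nat) (i : 'I_n) : free_nilpotent n r :=
  coset (lower_central (free_group 'I_n) r) (free_gen i).

Section Amalgam.
Local Open Scope group_scope.
Variables (A : groupType) (I : choiceType) (G_ : I -> groupType).
Variable iota : forall i, group_hom A (G_ i).

Let gen (i : I) (g : G_ i) : free_group {i : I & G_ i} :=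
  free_gen (Tagged (fun i => G_ i : Type) g).

Definition amalgam_relators : set (free_group {i : I & G_ i}) :=
  [set u | (exists i (g h : G_ i), u = gen g * gen h * (gen (g * h))^-1)
        \/ (exists i j (a : A), u = gen (iota i a) * (gen (iota j a))^-1)].

(* The amalgamated product of the groups G_ i along A, presented by all the    *)
(* elements of the G_ i, subject to the multiplication tables of the G_ i and  *)
(* the identifications of the images of A.                                     *)
Definition amalgam : groupType :=
  quotient_group (normal_closure amalgam_relators).

Definition amalgam_in (i : I) (g : G_ i) : amalgam :=
  coset (normal_closure amalgam_relators) (gen g).

Lemma coset_amalgam (u v : free_group {i : I & G_ i}) :
  amalgam_relators (u * v^-1) ->
  coset (normal_closure amalgam_relators) u =
  coset (normal_closure amalgam_relators) v.
Proof.
move=> /mem_normal_closure uv; apply/coset_eqP.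
have -> : u^-1 * v = ((u * v^-1)^-1) ^ u.
  by rewrite /conjg invgM invgK !mulgA mulgVK.
by rewrite gpredJ_normal// gpredV.
Qed.

Lemma amalgam_inM i : {morph @amalgam_in i : g h / g * h}.
Proof.
move=> g h; rewrite /amalgam_in -cosetM; apply/esym/coset_amalgam.
by left; exists i, g, h.
Qed.

Lemma amalgam_in1 i : @amalgam_in i 1 = 1.
Proof. by apply: (mulgI (amalgam_in (1 : G_ i))); rewrite -amalgam_inM !mulg1. Qed.

HB.instance Definition _ i :=
  isUMagmaMorphism.Build (G_ i) amalgam (@amalgam_in i)
    (amalgam_in1 i, @amalgam_inM i).

Lemma amalgam_in_iota i j a : amalgam_in (iota i a) = amalgam_in (iota j a).
Proof. by apply: coset_amalgam; right; exists i, j, a. Qed.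

(* The universal property, uniqueness aside. *)
Lemma amalgam_lift (H : groupType) (f : forall i, group_hom (G_ i) H) :
    (forall i j a, f i (iota i a) = f j (iota j a)) ->
  exists phi : group_hom amalgam H, forall i g, phi (@amalgam_in i g) = f i g.
Proof.
move=> fE; pose F := free_lift_hom (fun p : {i : I & G_ i} => f (tag p) (tagged p)).
have Fgen i g : F (@gen i g) = f i g by rewrite free_lift_gen.
have FN x : x \in normal_closure amalgam_relators -> F x = 1.
  move=> /generatedP; elim=> {x} [_ [r [y [ry ->]]]||x y _ hx _ hy|x _ hx].
  - rewrite gmulfJ; suff -> : F r = 1 by rewrite conj1g.
    case: ry => [[i [g [h ->]]]|[i [j [a ->]]]].
      by rewrite !gmulfM gmulfV !Fgen gmulfM mulgV.
    by rewrite gmulfM gmulfV !Fgen (fE i j) mulgV.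
  - exact: gmulf1.
  - by rewrite gmulfM hx hy mulg1.
  - by rewrite gmulfV hx invg1.
by exists (quot_lift_hom FN) => i g; exact: (etrans (quot_liftE FN _) (Fgen i g)).
Qed.

End Amalgam.

Section Subgroup.
Local Open Scope group_scope.
Variable G : groupType.

(* A subgroup, as a group in its own right. *)
Definition subgroup (S : groupClosed G) := {x : G | x \in S}.

Section Instances.
Variable S : groupClosed G.

Lemma subgroup_closed : group_closed (S : {pred G}).
Proof. by split; [apply: gpred1 | apply: gpredF]. Qed.

HB.instance Definition _ := SubChoice.on (subgroup S).
HB.instance Definition _ :=
  SubChoice_isSubGroup.Build G (mem S) (subgroup S) subgroup_closed.
End Instances.

Section Inclusion.
Variables (S T : groupClosed G) (ST : {subset S <= T}).

Definition subgroup_incl (x : subgroup S) : subgroup T :=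
  exist _ (val x) (ST (valP x)).

Lemma subgroup_incl_morph : monoid.monoid_morphism subgroup_incl.
Proof. by split=> [|x y]; apply: val_inj. Qed.
HB.instance Definition _ := isUMagmaMorphism.Build (subgroup S) (subgroup T)
  subgroup_incl subgroup_incl_morph.
End Inclusion.

End Subgroup.

Section SU2.
Local Open Scope ring_scope.
Local Open Scope complex_scope.
Local Open Scope sesquilinear_scope.
Variable R : realType.

Record SU2 := MkSU2 {
  SU2_val :> 'M[R[i]]_2;
  _ : (SU2_val \is unitarymx) && (\det SU2_val == 1)
}.
HB.instance Definition _ := [isSub for SU2_val].
HB.instance Definition _ := [Choice of SU2 by <:].

Lemma SU2_unitary (A : SU2) : (A : 'M_2) \is unitarymx.
Proof. by case/andP: (valP A). Qed.
Lemma SU2_det (A : SU2) : \det (A : 'M_2) = 1.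
Proof. by case/andP: (valP A) => _ /eqP. Qed.

Lemma SU2_one_proof : ((1%:M : 'M[R[i]]_2) \is unitarymx) && (\det (1%:M : 'M[R[i]]_2) == 1).
Proof. by rewrite det1 eqxx andbT; apply/unitarymxP; rewrite mul1mx trmx1 map_mx1. Qed.
Lemma SU2_mul_proof (A B : SU2) : ((A : 'M_2) *m B \is unitarymx) && (\det ((A : 'M_2) *m B) == 1).
Proof. by rewrite mul_unitarymx ?SU2_unitary//= det_mulmx !SU2_det mulr1. Qed.
Lemma SU2_inv_proof (A : SU2) : ((A : 'M_2) ^t* \is unitarymx) && (\det ((A : 'M_2) ^t*) == 1).
Proof. by rewrite trmxC_unitary SU2_unitary/= det_map_mx det_tr SU2_det rmorph1. Qed.

Definition SU2_one := MkSU2 SU2_one_proof.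
Definition SU2_mul A B := MkSU2 (SU2_mul_proof A B).
Definition SU2_inv A := MkSU2 (SU2_inv_proof A).

Lemma SU2_mulA : associative SU2_mul.
Proof. by move=> A B C; apply: val_inj; rewrite /= mulmxA. Qed.
Lemma SU2_mul1g : left_id SU2_one SU2_mul.
Proof. by move=> A; apply: val_inj; rewrite /= mul1mx. Qed.
Lemma SU2_mulg1 : right_id SU2_one SU2_mul.
Proof. by move=> A; apply: val_inj; rewrite /= mulmx1. Qed.
Lemma SU2_mulgV : right_inverse SU2_one SU2_inv SU2_mul.
Proof. by move=> A; apply: val_inj; rewrite /= (unitarymxP _) ?SU2_unitary. Qed.
Lemma SU2_mulVg : left_inverse SU2_one SU2_inv SU2_mul.
Proof.
by move=> A; apply: val_inj; rewrite /= -invmx_unitary ?SU2_unitary// mulVmx//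
  unitarymx_unit ?SU2_unitary.
Qed.

HB.instance Definition _ := isGroup.Build SU2
  SU2_mulA SU2_mul1g SU2_mulg1 SU2_mulVg SU2_mulgV.

Definition mx22 (a b c d : R[i]) : 'M[R[i]]_2 :=
  \matrix_(i, j) if i == 0 then (if j == 0 then a else b)
                 else (if j == 0 then c else d).

Lemma mx22M a b c d a' b' c' d' :
  mx22 a b c d *m mx22 a' b' c' d' =
  mx22 (a * a' + b * c') (a * b' + b * d') (c * a' + d * c') (c * b' + d * d').
Proof.
apply/matrixP => i j; rewrite !mxE !big_ord_recl big_ord0 !mxE /= addr0.
by case: (i == 0); case: (j == 0).
Qed.

Lemma mx22_trC a b c d :
  (mx22 a b c d) ^t* = mx22 (conjc a) (conjc c) (conjc b) (conjc d).
Proof. by apply/matrixP => i j; rewrite !mxE; case: (i == 0); case: (j == 0). Qed.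

Lemma mx22_1 : mx22 1 0 0 1 = 1%:M.
Proof. by apply/matrixP => -[[|[|//]] ?] [[|[|//]] ?]; rewrite !mxE. Qed.

Lemma det_mx22 a b c d : \det (mx22 a b c d) = a * d - b * c.
Proof.
rewrite (expand_det_row _ 0) !big_ord_recl big_ord0 addr0 /cofactor !det_mx11 !mxE /=.
by rewrite expr0 expr1 mul1r mulN1r mulrN.
Qed.

(* The complex number e^(it). *)
Definition cis (t : R) : R[i] := cos t +i* sin t.

Lemma cisD t u : cis (t + u) = cis t * cis u.
Proof. by rewrite /cis cosD sinD; simpc; rewrite [sin t * _ + _]addrC. Qed.
Lemma cis0 : cis 0 = 1.
Proof. by rewrite /cis cos0 sin0. Qed.
Lemma conj_cis t : conjc (cis t) = cis (- t).
Proof. by rewrite /cis cosN sinN. Qed.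
Lemma cisNt t : cis t * cis (- t) = 1.
Proof. by rewrite -cisD subrr cis0. Qed.
Lemma cistN t : cis (- t) * cis t = 1.
Proof. by rewrite mulrC cisNt. Qed.

Lemma rot_proof t : (mx22 (cis t) 0 0 (cis (- t)) \is unitarymx) &&
  (\det (mx22 (cis t) 0 0 (cis (- t))) == 1).
Proof.
rewrite det_mx22 mul0r subr0 cisNt eqxx andbT; apply/unitarymxP.
rewrite mx22_trC mx22M !conj_cis opprK !conjc0 !mulr0 !mul0r !addr0 !add0r.
by rewrite cisNt cistN mx22_1.
Qed.

Definition rot (t : R) : SU2 := MkSU2 (rot_proof t).

Lemma w_proof : (mx22 0 (-1) 1 0 \is unitarymx) && (\det (mx22 0 (-1) 1 0) == 1).
Proof.
rewrite det_mx22 mul0r sub0r mulr1 opprK eqxx andbT; apply/unitarymxP.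
rewrite mx22_trC mx22M rmorphN conjc0 conjc1 !mulr0 !mul0r !addr0 !add0r.
by rewrite rmorph1 mulrNN !mulr1 mx22_1.
Qed.

Definition SU2_w : SU2 := MkSU2 w_proof.

Lemma rotD t u : rot (t + u) = (rot t * rot u)%g.
Proof.
apply: val_inj; rewrite /= mx22M !mulr0 !mul0r !addr0 !add0r.
by rewrite opprD !cisD.
Qed.
Lemma rot0 : rot 0 = 1%g.
Proof. by apply: val_inj; rewrite /= oppr0 cis0 mx22_1. Qed.
Lemma rotN t : rot (- t) = (rot t)^-1%g.
Proof. by apply: (mulgI (rot t)); rewrite -rotD subrr rot0 mulgV. Qed.
Lemma rotX t n : (rot t ^+ n)%g = rot (t *+ n).
Proof. by elim: n => [|n IH]; rewrite ?rot0// expgS IH -rotD -mulrS. Qed.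
Lemma rot_w t : (SU2_w^-1 * rot t * SU2_w)%g = (rot t)^-1%g.
Proof.
rewrite -mulgA; apply: (mulgI SU2_w); rewrite mulVKg -rotN.
apply: val_inj; rewrite /= !mx22M !(mulr0, mul0r, addr0, add0r) opprK.
by rewrite !mulr1 !mul1r mulrN1 mulN1r.
Qed.
Lemma w_sq : (SU2_w * SU2_w)%g = rot pi.
Proof.
apply: val_inj; rewrite /= !mx22M !(mulr0, mul0r, addr0, add0r, mulr1, mul1r).
by rewrite /cis cosN sinN cospi sinpi oppr0; congr mx22; simpc.
Qed.

(* The cyclic subgroup mu_m, for m > 0. *)
Definition mu (m : nat) : {pred SU2} := generated [set rot (2 * pi / m%:R)].
HB.instance Definition _ m := GroupClosed.on (mu m).

Lemma mem_mu_rot m k : rot (2 * pi / m%:R *+ k) \in mu m.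
Proof. by rewrite -rotX gpredXn// mem_generated. Qed.

Lemma mu_sub (a b : nat) : (a <= b)%N -> {subset mu (2 ^ a) <= mu (2 ^ b)}.
Proof.
move=> ab; apply: generated_sub => _ ->.
have -> : 2 * pi / (2 ^ a)%:R = 2 * pi / (2 ^ b)%:R *+ 2 ^ (b - a) :> R.
  rewrite -[RHS]mulr_natr -[in RHS](subnK ab) expnD natrM invfM.
  rewrite addnK [(2 ^ (b - a))%:R^-1 * _]mulrC.
  by rewrite -!mulrA mulVf ?mulr1// pnatr_eq0 expn_eq0.
exact: mem_mu_rot.
Qed.

Lemma mu_w m A : A \in mu m -> (SU2_w^-1 * A * SU2_w)%g \in mu m.
Proof.
move=> /generatedP; elim=> {A} [_ ->||A B _ hA _ hB|A _ hA].
- by rewrite rot_w gpredV mem_generated.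
- by rewrite mulg1 mulVg gpred1.
- have -> : (SU2_w^-1 * (A * B) * SU2_w = SU2_w^-1 * A * SU2_w * (SU2_w^-1 * B * SU2_w))%g.
    by rewrite !mulgA mulgK.
  exact: gpredM.
- have -> : (SU2_w^-1 * A^-1 * SU2_w = (SU2_w^-1 * A * SU2_w)^-1)%g.
    by rewrite !invgM invgK mulgA.
  exact: gpredVr.
Qed.

(* The underlying set of Q_(2^s); it is a subgroup when s >= 2. *)
Definition Q2_set (s : nat) : {pred SU2} := fun A =>
  `[< A \in mu (2 ^ (s - 1)) \/ exists2 B, B \in mu (2 ^ (s - 1)) & A = (SU2_w * B)%g >].

Lemma mu_Q2 s : {subset mu (2 ^ (s - 1)) <= Q2_set s}.
Proof. by move=> A hA; apply/asboolP; left. Qed.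

Section Q2.
Variables (s : nat) (hs : (2 <= s)%N).

Lemma w_sq_mu : (SU2_w * SU2_w)%g \in mu (2 ^ (s - 1)).
Proof.
rewrite w_sq; have -> : pi = 2 * pi / (2 ^ (s - 1))%:R *+ 2 ^ s.-2 :> R.
  case: s hs => [|[|k]] //= _.
  rewrite -[RHS]mulr_natr expnS natrM invfM -!mulrA mulVf; last first.
    by rewrite pnatr_eq0 expn_eq0.
  by rewrite mulr1 mulrCA mulfV ?mulr1// pnatr_eq0.
exact: mem_mu_rot.
Qed.

Lemma Q2_mulM : mulg_closed (Q2_set s).
Proof.
move=> A B /asboolP hA /asboolP hB; apply/asboolP.
case: hA hB => [hA|[A' hA ->]] [hB|[B' hB ->]].
- by left; apply: gpredM.
- right; exists (SU2_w^-1 * A * SU2_w * B')%g; first by rewrite gpredM// mu_w.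
  by rewrite !mulgA mulgV mul1g.
- by right; exists (A' * B)%g; rewrite ?gpredM// mulgA.
- left; have -> : (SU2_w * A' * (SU2_w * B') =
      SU2_w * SU2_w * (SU2_w^-1 * A' * SU2_w) * B')%g by rewrite !mulgA mulgK.
  by apply: gpredM hB; apply: gpredM w_sq_mu _; apply: mu_w.
Qed.

Lemma Q2_mem1 : 1%g \in Q2_set s.
Proof. by apply: mu_Q2; apply: gpred1. Qed.

Lemma Q2_invr : invg_closed (Q2_set s).
Proof.
move=> A /asboolP hA; apply/asboolP.
case: hA => [hA|[B hB ->]]; first by left; apply: gpredVr.
right; exists (SU2_w^-1 * B^-1 * SU2_w * (SU2_w * SU2_w)^-1)%g.
  by apply: gpredM; [apply: mu_w; apply: gpredVr | apply/gpredVr/w_sq_mu].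
by rewrite !invgM !mulgA mulgV mul1g mulgK.
Qed.

(* The subgroup Q_(2^s) of SU(2). *)
Definition Q2 : groupClosed SU2 :=
  HB.pack (Q2_set s) (isMulClosed.Build SU2 (Q2_set s) Q2_mulM)
    (isMul1Closed.Build SU2 (Q2_set s) Q2_mem1)
    (isInvClosed.Build SU2 (Q2_set s) Q2_invr).
End Q2.

End SU2.

Arguments mu : clear implicits.
Arguments Q2_set : clear implicits.
Arguments Q2 : clear implicits.

Section Simplicial.

(* Nondecreasing maps from {0, ..., m} to {0, ..., n}. *)
Record ordmap (m n : nat) := OrdMap {
  ordmap_fun :> 'I_m.+1 -> 'I_n.+1;
  ordmapP : forall i j : 'I_m.+1, i <= j -> ordmap_fun i <= ordmap_fun j
}.

Definition ordmap_id (n : nat) : ordmap n n := OrdMap (fun i j : 'I_n.+1 => id).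

Definition ordmap_comp (m n p : nat) (f : ordmap n p) (g : ordmap m n) : ordmap m p :=
  OrdMap (fun i j ij => ordmapP f (ordmapP g ij)).

(* Simplicial sets. *)
Record sset := SSet {
  sobj :> nat -> choiceType;
  sact : forall m n, ordmap m n -> sobj n -> sobj m;
  sact_id : forall n (x : sobj n), sact (ordmap_id n) x = x;
  sact_comp : forall m n p (f : ordmap n p) (g : ordmap m n) (x : sobj p),
    sact (ordmap_comp f g) x = sact g (sact f x)
}.

Section SubSSet.
Variables (X : sset) (P : forall n, pred (X n)).
Hypothesis PX : forall m n (f : ordmap m n) (x : X n), P x -> P (sact f x).

Definition sub_sset_obj (n : nat) : choiceType := {x : X n | P x}.

Definition sub_sset_act m n (f : ordmap m n) (x : sub_sset_obj n) : sub_sset_obj m :=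
  exist _ (sact f (val x)) (PX f (valP x)).

Lemma sub_sset_id n (x : sub_sset_obj n) : sub_sset_act (ordmap_id n) x = x.
Proof. by apply: val_inj; rewrite /= sact_id. Qed.

Lemma sub_sset_comp m n p (f : ordmap n p) (g : ordmap m n) (x : sub_sset_obj p) :
  sub_sset_act (ordmap_comp f g) x = sub_sset_act g (sub_sset_act f x).
Proof. by apply: val_inj; rewrite /= sact_comp. Qed.

Definition sub_sset : sset := SSet sub_sset_id sub_sset_comp.
End SubSSet.

Section Nerve.
Local Open Scope group_scope.
Variable G : groupType.

(* In bar notation: the k-th entry of the image of (g_1, ..., g_n) is the      *)
(* ordered product of the g_j with f(k-1) < j <= f(k). With entries indexed    *)
(* from 0 this says f(k) <= j < f(k+1). The cofaces and codegeneracies yield   *)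
(* the usual faces (drop an outer entry, or multiply two adjacent entries) and *)
(* degeneracies (insert a 1).                                                  *)
Definition nerve_act m n (f : ordmap m n) (g : {ffun 'I_n -> G}) : {ffun 'I_m -> G} :=
  [ffun k : 'I_m =>
    \prod_(j < n | f (widen_ord (leqnSn m) k) <= j < f (lift ord0 k)) g j].

Lemma prod_interval_cat n (g : 'I_n -> G) (a b c : nat) : a <= b <= c ->
  (\prod_(j < n | a <= j < b) g j) * (\prod_(j < n | b <= j < c) g j) =
  \prod_(j < n | a <= j < c) g j.
Proof.
case/andP=> ab bc; elim: n g => [|n IH] g; first by rewrite !big_ord0 mulg1.
have recr u v : \prod_(j < n.+1 | u <= j < v) g j =
    \prod_(j < n | u <= j < v) g (widen_ord (leqnSn n) j) *
    (if u <= n < v then g ord_max else 1).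
  by rewrite big_mkcond big_ord_recr /= -big_mkcond.
rewrite !recr.
have /= <- := IH (fun i => g (widen_ord (leqnSn n) i)); case: (leqP b n) => [bn|nb].
  by rewrite (leq_trans ab bn) /= mulg1 !mulgA.
rewrite [X in _ * _ * (X * _)]big_pred0 => [|j]; last first.
  by apply/negbTE; rewrite negb_and -ltnNge (ltn_trans (ltn_ord j) nb).
rewrite [X in _ = _ * X * _]big_pred0 => [|j]; last first.
  by apply/negbTE; rewrite negb_and -ltnNge (ltn_trans (ltn_ord j) nb).
by rewrite (leq_trans nb bc) !mulg1.
Qed.

Lemma nerve_id n (g : {ffun 'I_n -> G}) : nerve_act (ordmap_id n) g = g.
Proof.
apply/ffunP=> k; rewrite ffunE (big_pred1 k) // => j /=.
by rewrite -eqn_leq eq_sym.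
Qed.

Lemma nerve_comp m n p (f : ordmap n p) (g : ordmap m n) (x : {ffun 'I_p -> G}) :
  nerve_act (ordmap_comp f g) x = nerve_act g (nerve_act f x).
Proof.
apply/ffunP=> k; rewrite !ffunE /=.
set a := g (widen_ord _ k); set b := g (lift ord0 k).
have ab : a <= b by apply: ordmapP.
pose c (l : nat) : nat := f (inord (minn l n)).
have cE (i : 'I_n.+1) : f i = c i :> nat.
  by rewrite /c (minn_idPl _) ?inord_val// -ltnS.
have cmono i j : i <= j -> c i <= c j.
  move=> ij; apply: ordmapP; rewrite !inordK ?ltnS ?geq_minr//.
  by rewrite leq_min geq_minr geq_min ij.
rewrite !cE.
under [RHS]eq_bigr => l _ do rewrite ffunE !cE /= /bump leq0n add1n.
have bn : b <= n by rewrite -ltnS.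
elim: {b}(b : nat) ab bn => [|b IH].
  rewrite leqn0 => /eqP-> _; rewrite [RHS]big_pred0 ?big_pred0// => j.
  by rewrite leqNgt andNb.
rewrite leq_eqVlt => /predU1P[<- _|]; last first.
  rewrite ltnS => ab bn.
  rewrite -(@prod_interval_cat _ _ a b b.+1) ?ab ?leqnSn//.
  rewrite -(IH ab (ltnW bn)) (big_pred1 (Ordinal bn)); last first.
    by move=> j /=; rewrite -val_eqE /= ltnS eqn_leq andbC.
  by rewrite prod_interval_cat// !cmono.
by rewrite [LHS]big_pred0 ?[RHS]big_pred0// => j; rewrite leqNgt andNb.
Qed.

Definition nerve : sset := @SSet (fun n => {ffun 'I_n -> G}) nerve_act nerve_id nerve_comp.

(* Hom(F_n / Gamma^r_n, G) as a subset of G^n, through the images of the free  *)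
(* generators.                                                                 *)
Definition is_nilpotent_hom (r n : nat) (g : {ffun 'I_n -> G}) : bool :=
  `[< exists phi : group_hom (free_nilpotent n r) G,
        forall i, phi (free_nilpotent_gen r i) = g i >].

Lemma is_nilpotent_hom_act r m n (f : ordmap m n) (g : nerve n) :
  is_nilpotent_hom r g -> is_nilpotent_hom r (sact f g : nerve m).
Proof.
move=> /asboolP[phi phiE]; apply/asboolP.
pose N := lower_central (free_group 'I_n) r.
pose y (k : 'I_m) : free_group 'I_n :=
  \prod_(j < n | f (widen_ord (leqnSn m) k) <= j < f (lift ord0 k)) free_gen j.
pose psi := phi \o coset N \o free_lift_hom y : group_hom _ _.
have psiN x : x \in lower_central (free_group 'I_m) r -> psi x = 1.
  move=> /(lower_central_hom (free_lift_hom y)) xN.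
  rewrite /psi /=; transitivity (phi 1); last exact: gmulf1.
  congr (phi _); apply/esym/coset_eqP.
  by rewrite invg1 mul1g.
exists (quot_lift_hom psiN) => k; rewrite [LHS](quot_liftE psiN) /psi.
rewrite [LHS]/(phi (coset N (free_lift_hom y (free_gen k)))).
transitivity (phi (coset N (y k))).
  by congr (phi (coset N _)); exact: free_lift_gen.
rewrite gmulf_prod gmulf_prod /= ffunE; apply: eq_bigr => j _.
by rewrite -phiE.
Qed.

(* The simplicial set Hom(F_* / Gamma^r_*, G). *)
Definition nilpotent_nerve (r : nat) : sset := sub_sset (@is_nilpotent_hom_act r).

End Nerve.
End Simplicial.

Section Realization.
Local Open Scope ring_scope.
Local Open Scope classical_set_scope.
Local Open Scope quotient_scope.
Variable R : realType.

Definition simplex (n : nat) : set 'rV[R]_n.+1 :=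
  [set t | (forall i, 0 <= t 0 i) /\ \sum_i t 0 i = 1].

Definition simplex_pushforward m n (f : ordmap m n) (t : 'rV[R]_m.+1) : 'rV[R]_n.+1 :=
  \row_j \sum_(i | f i == j) t 0 i.

Lemma simplex_pushforward_in m n (f : ordmap m n) t : simplex t -> simplex (simplex_pushforward f t).
Proof.
case=> t0 t1; split=> [j|]; first by rewrite mxE sumr_ge0.
by rewrite -t1 (partition_big f predT)//=; apply: eq_bigr => j _; rewrite mxE.
Qed.

Definition simplex_push m n (f : ordmap m n) (t : set_type (simplex (n := m))) :
  set_type (simplex (n := n)) :=
  exist _ (simplex_pushforward f (val t)) (mem_set (simplex_pushforward_in f (set_mem (valP t)))).

Variable X : sset.

(* The disjoint union, over all n and all x in X_n, of copies of the standard  *)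
(* n-simplex; it is the disjoint union of the X_n * Delta^n, X_n being discrete. *)
Definition cells : topologicalType :=
  {p : {n : nat & X n} & set_type (simplex (n := tag p))}.

Definition cell n (x : X n) (t : set_type (simplex (n := n))) : cells :=
  existT (fun p : {n : nat & X n} => set_type (simplex (n := tag p)) : Type)
    (existT (fun n => X n : Type) n x) t.

Inductive realization_eqv : cells -> cells -> Prop :=
| realization_refl a : realization_eqv a a
| realization_sym a b : realization_eqv a b -> realization_eqv b a
| realization_trans a b c :
    realization_eqv a b -> realization_eqv b c -> realization_eqv a c
| realization_glue m n (f : ordmap m n) (x : X n) (t : set_type (simplex (n := m))) :
    realization_eqv (cell (sact f x) t) (cell x (simplex_push f t)).

Definition realization_rel : rel cells := fun a b => `[< realization_eqv a b >].

Lemma realization_rel_refl : reflexive realization_rel.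
Proof. by move=> a; apply/asboolP; apply: realization_refl. Qed.
Lemma realization_rel_sym : symmetric realization_rel.
Proof. by move=> a b; apply/asboolP/asboolP; apply: realization_sym. Qed.
Lemma realization_rel_trans : transitive realization_rel.
Proof.
by move=> b a c /asboolP ab /asboolP bc; apply/asboolP; apply: realization_trans ab bc.
Qed.

Definition realization_equiv :=
  EquivRel realization_rel realization_rel_refl realization_rel_sym
    realization_rel_trans.

(* The geometric realization of X. *)
Definition realization : topologicalType :=
  quotient_topology {eq_quot realization_equiv}.

End Realization.

Section HomotopyEquivalence.
Local Open Scope ring_scope.
Local Open Scope classical_set_scope.
Variable R : realType.

Definition homotopic (X Y : topologicalType) (f g : X -> Y) : Prop :=
  exists H : X * R -> Y,
    [/\ {within [set: X] `*` `[0, 1], continuous H},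
        forall x, H (x, 0) = f x & forall x, H (x, 1) = g x].

Definition homotopy_equivalent (X Y : topologicalType) : Prop :=
  exists (f : X -> Y) (g : Y -> X),
    [/\ continuous f, continuous g, homotopic (g \o f) idfun & homotopic (f \o g) idfun].

End HomotopyEquivalence.

(* The space B(r, G), for a discrete group G. *)
Definition nilpotent_classifying_space (R : realType) (r : nat) (G : groupType) :
  topologicalType := realization R (nilpotent_nerve G r).

(* The classifying space of a discrete group G. *)
Definition classifying_space (R : realType) (G : groupType) : topologicalType :=
  realization R (nerve G).

Section QMuAmalgam.
Variables (R : realType) (q r : nat) (hr : 2 <= r) (hrq : r <= q).

(* [Some k] indexes the k-th copy of Q_(2^r), [None] indexes mu_(2^q). *)
Definition Q_mu_factor (i : option 'I_(2 ^ (q.+1 - r))) : groupType :=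
  if i is Some _ then subgroup (Q2 R r hr) else subgroup (mu R (2 ^ q)).

Definition Q_mu_incl (i : option 'I_(2 ^ (q.+1 - r))) :
    group_hom (subgroup (mu R (2 ^ (r - 1)))) (Q_mu_factor i) :=
  match i with
  | Some _ => @subgroup_incl _ (mu R (2 ^ (r - 1))) (Q2 R r hr) (@mu_Q2 R r)
  | None => @subgroup_incl _ _ _ (mu_sub (leq_trans (leq_subr 1 r) hrq))
  end.

Definition Q_mu_amalgam : groupType := amalgam Q_mu_incl.

End QMuAmalgam.

(* Main.v *)
(* Identify a point of the realization of the nerve of a discrete group K with a
   step function on [0, 1) with values in K, given by a sequence x_0, ..., x_n in
   K and barycentric coordinates t, up to left translation. By nilpotency, the
   simplicial set Hom(F_*/Gamma^r_*, Q_(2^(q+1))) is the union of the nerves of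
   the maximal subgroups of class less than r, namely mu_(2^q) and the 2^(q+1-r)
   conjugates of Q_(2^r), any two of which meet in mu_(2^(r-1)).

   Let K be the amalgam of these subgroups H_i along their common intersection A.
   K acts on its Bass-Serre tree, with vertices the cosets yA and yH_i. The
   barycenter of the points x_k A with masses t_k (the minimizer of the sum of
   the t_k d(-, x_k A)^2) lies on an edge (yA, yH_i); it depends continuously and
   equivariantly on (x, t), because the slopes along the edges are linear in t.
   Replacing each x_k by a join of its projections to yA and to yH_i, with weights
   given by the position of the barycenter on the edge, retracts the classifying
   space of K to the union of those of the H_i; the join of x with its image is
   the homotopy. *)

From HB Require Import structures.
Require Import Defs.
From mathcomp Require Import all_boot all_order all_algebra monoid.
From mathcomp Require Import generic_quotient complex.
From mathcomp Require Import all_classical reals topology normedtype trigo.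
From mathcomp Require Import ring lra zify.

Set Implicit Arguments.
Unset Strict Implicit.
Unset Printing Implicit Defensive.

Import Order.TTheory GRing.Theory Num.Theory numFieldTopology.Exports numFieldNormedType.Exports.
Local Open Scope classical_set_scope.

(** * Convex functions on the Bass-Serre tree *)

(** Edges have length 1. Along the edge from yA to yH_i, half the sum of the t_k d(-, x_k A)^2 has
    derivative c - U at distance c from yA, where U is the t-average of the signed distances of the
    y^-1 x_k. So the minimum over that edge lies at U clamped to [0, 1], and this number is the
    weight given to the projection to yH_i. This is the origin of the thresholds 0 and 1 for slopes;
    the constant 2 is the distance between neighbouring cosets of A. The minimal edge is ambiguous
    only when the barycenter is a vertex, and then the projection that depends on the choice has
    weight 0. The tree itself is never built: only the signed distance from A enters, and normal
    forms in the amalgam provide it. The factors are finite, so finitely many edges serve for all t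
    and continuity follows by pasting closed pieces. A join is one large simplex whose vertices are
    copies of those of x, block after block; no prism has to be triangulated. Over the union of the
    nerves the blocks must span a simplex of a single nerve, which restricts the edges that may be
    chosen. *)

Section Barycenter.
Local Open Scope group_scope.
Variables (R : realFieldType) (K : groupType) (I : choiceType).
Variables (A : set K) (H : I -> set K).
Hypothesis AM : forall {a b}, A a -> A b -> A (a * b).
Hypothesis AV : forall {a}, A a -> A a^-1.
Hypothesis A1 : A 1.
Hypothesis AH : forall {i a}, A a -> H i a.
Hypothesis HM : forall {i a b}, H i a -> H i b -> H i (a * b).
Hypothesis HV : forall {i a}, H i a -> H i a^-1.
Hypothesis genK : forall P : K -> Prop, P 1 ->
  (forall g i h, P g -> H i h -> P (g * h)) -> forall g, P g.

(** Reduced words. The index is the factor of the last letter, so the path from A to gA ends with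
    the edge from gH_i to gA. *)
Inductive alternating : I -> K -> Prop :=
| alternating1 i h : H i h -> ~ A h -> alternating i h
| alternatingM i j g h : alternating j g -> j != i -> H i h -> ~ A h ->
    alternating i (g * h).

Lemma notAM i a h : H i h -> ~ A h -> A a -> ~ A (h * a).
Proof. by move=> Hh nA Aa /AM/(_ (AV Aa)); rewrite mulgK. Qed.

Lemma alternating_mulA i g a : alternating i g -> A a -> alternating i (g * a).
Proof.
case=> {i g} [i h Hh nA|i j g h gj ji Hh nA] Aa.
  by apply: alternating1; [apply: HM Hh (AH Aa)|apply: (notAM Hh)].
rewrite -mulgA; apply: alternatingM gj ji _ _; first exact: HM Hh (AH Aa).
exact: notAM Hh nA Aa.
Qed.

Lemma alternating_total g : A g \/ exists i, alternating i g.
Proof.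
elim/genK: g => [|g i h IH Hh]; first by left.
case: (pselect (A h)) => [Ah|nAh].
  case: IH => [Ag|[j gj]]; first by left; apply: AM.
  by right; exists j; apply: alternating_mulA.
case: IH => [Ag|[j gj]].
  right; exists i; apply: alternating1; first exact: HM (AH Ag) Hh.
  by move=> Agh; apply: nAh; rewrite -[h](mulKg g); apply: AM => //; apply: AV.
have [ji|ji] := eqVneq j i; last by right; exists i; apply: alternatingM gj _ _ _.
subst j; case: gj Hh => {}i.
  move=> k Hk nAk Hh; case: (pselect (A (k * h))) => [Akh|nAkh]; first by left.
  by right; exists i; apply: alternating1 => //; apply: HM.
move=> j {}g k gj ji Hk nAk Hh.
rewrite -mulgA; case: (pselect (A (k * h))) => [Akh|nAkh].
  by right; exists j; apply: alternating_mulA.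
by right; exists i; apply: alternatingM gj ji (HM Hk Hh) nAkh.
Qed.

Section Potential.
Local Open Scope ring_scope.
Variable U : I -> K -> R.

(* [U i y] is the slope of a convex function at the edge from the vertex y A to
   the vertex y H_i of the Bass-Serre tree: the sum of the slopes along two
   edges leaving a common vertex is bounded, so that the minimum is unique. *)
Definition convex_slopes :=
  [/\ forall a y i, A a -> U i (y * a)%g = U i y,
      forall i j y, i != j -> U i y + U j y <= 0
    & forall i h y, H i h -> ~ A h -> 2 <= U i y + U i (y * h)%g].

(** A slope at most 0 puts the minimum over an edge at its A-end, a slope at least 1 at its H-end.
    So every other edge at either end of [e] has its minimum at the shared vertex; by convexity the
    global minimum lies on [e]. *)
Definition minimal_edge (e : K * I) :=
  (forall j, j != e.2 -> U j e.1 <= 0) /\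
  (forall h, H e.2 h -> ~ A h -> 1 <= U e.2 (e.1 * h)%g).

Hypothesis hU : convex_slopes.

Lemma minimal_edge_interior y i : 0 <= U i y <= 1 -> minimal_edge (y, i).
Proof.
case: hU => _ h2 h3 /andP[u0 u1]; split=> /= [j ji|h Hh nA].
  by have := h2 _ _ y ji; lra.
by have := h3 _ _ y Hh nA; lra.
Qed.

Lemma minimal_edge_vertex y i : (forall j, U j y <= 0) -> minimal_edge (y, i).
Proof.
case: hU => _ h2 h3 u0; split=> //= h Hh nA.
by have := h3 _ _ y Hh nA; have := u0 i; lra.
Qed.

(** When no slope leads out of the star of yH_i, the minimum lies in that star, on an edge of type
    [i]. This serves the simplices of the nerve of H_i, whose joins must stay in that nerve. *)
Lemma minimal_edge_in y i : (forall j, j != i -> forall h, H i h -> U j (y * h)%g <= 0) ->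
  exists2 h, H i h & minimal_edge ((y * h)%g, i).
Proof.
case: (hU) => h1 h2 h3 Uj.
have H1 : H i 1%g by apply: AH.
case: (pselect (exists2 h, H i h & U i (y * h)%g < 1)) => [[h Hh lt1]|ge1].
  exists h => //; have [u0|u0] := leP 0 (U i (y * h)%g).
    by apply: minimal_edge_interior; rewrite u0 ltW.
  apply: minimal_edge_vertex => j; have [->|/Uj] := eqVneq j i; first exact: ltW.
  exact.
(* All slopes in the star are at least 1: the minimum is at yH_i and any of its edges will do. *)
exists 1%g => //; split=> /= [j ji|h Hh _]; first exact: Uj.
by rewrite mulg1 leNgt; apply/negP => lt1; apply: ge1; exists h.
Qed.

Variable Hs : seq K.
Hypothesis HsP : forall {i h}, H i h -> h \in Hs.

Fixpoint word_ball n : seq K :=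
  if n is m.+1 then word_ball m ++ [seq (y * h)%g | y <- word_ball m, h <- Hs]
  else [:: 1%g].

Lemma word_ball_mono m n : (m <= n)%N -> {subset word_ball m <= word_ball n}.
Proof.
elim: n => [|n IH]; first by rewrite leqn0 => /eqP->.
rewrite leq_eqVlt => /predU1P[->//|/IH h] x /h xn.
by rewrite /= mem_cat xn.
Qed.

(** Descent: while the minimum is not on an edge at hand, move from yA to yhA across yH_i. Convexity
    bounds each slope at the new vertex by the old slope minus 2 or by 0, so [N] moves suffice. *)
Lemma minimal_edge_exists (i0 : I) N : (forall i, U i 1%g <= 2 * N%:R) ->
  exists2 e, minimal_edge e & e.1 \in word_ball N.
Proof.
case: (hU) => h1 h2 h3 U1.
suff : forall n y, y \in word_ball n -> (forall i, U i y <= 2 * N%:R) ->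
    exists2 e, minimal_edge e & e.1 \in word_ball (n + N).
  by move/(_ 0%N 1%g); apply => //; rewrite inE.
elim: N {U1} => [|N IH] n y yn Uy.
  exists (y, i0); last by rewrite addn0.
  by apply: minimal_edge_vertex => j; have := Uy j; rewrite mulr0.
have yn1 : y \in word_ball (n + N.+1) by apply: word_ball_mono yn; apply: leq_addr.
case: (pselect (exists i, 0 < U i y)) => [[i Ui0]|U0]; last first.
  exists (y, i0) => //; apply: minimal_edge_vertex => j.
  by rewrite leNgt; apply/negP=> Uj; apply: U0; exists j.
have [Ui1|Ui1] := leP (U i y) 1.
  by exists (y, i) => //; apply: minimal_edge_interior; rewrite Ui1 ltW.
case: (pselect (exists h, [/\ H i h, ~ A h & U i (y * h)%g < 1])); last first.
  move=> nh; exists (y, i) => //; split=> /= [j ji|h Hh nAh].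
    by have := h2 _ _ y ji; lra.
  by rewrite leNgt; apply/negP=> lt1; apply: nh; exists h.
case=> h [Hh nAh lt1].
have yhn : (y * h)%g \in word_ball n.+1.
  rewrite /= mem_cat; apply/orP; right; apply/allpairsP; exists (y, h).
  by split=> //; apply: HsP Hh.
have [u0|u0] := leP 0 (U i (y * h)%g).
  exists ((y * h)%g, i); first by apply: minimal_edge_interior; rewrite u0 ltW.
  by apply: word_ball_mono yhn; rewrite addnS ltnS leq_addr.
have [|e eG eB] := IH n.+1 _ yhn; last by exists e => //; rewrite addnS -addSn.
move=> j; have := Uy i; rewrite -natr1; have := h3 _ _ y Hh nAh.
have [->|ji] := eqVneq j i; first by have := ler0n R N; lra.
by have := h2 _ _ (y * h)%g ji; lra.
Qed.

(** Away from a minimal edge the function keeps growing, so the last edge of the path from [y] to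
    [y * g] has its minimum at the end nearer to [y]. The second clause records the edge before it,
    on which a minimal edge at [y * g] of the same type would impose the opposite sign. *)
Lemma slope_alternating y i j g : minimal_edge (y, i) -> alternating j g ->
  1 <= U j (y * g)%g /\
  ((H j g /\ ~ A g) \/ exists h, [/\ H j h, ~ A h & U j (y * g * h^-1)%g <= -1]).
Proof.
case: hU => h1 h2 h3 [G1 G2]; elim=> {j g} [j h Hh nAh|j k g h gk [IH _] kj Hh nAh].
  split; last by left.
  have [ji|ji] := eqVneq j i; first by subst j; exact: G2.
  by have := G1 _ ji; have := h3 _ _ y Hh nAh; rewrite /=; lra.
have Uj : U j (y * g)%g <= -1 by have := h2 _ _ (y * g)%g kj; lra.
split; last by right; exists h; rewrite mulgA mulgK.
by rewrite mulgA; have := h3 _ _ (y * g)%g Hh nAh; lra.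
Qed.

(** The minimum is unique, so two minimal edges are equal or share the vertex where it is attained:
    yA, with both slopes at most 0, or yH_i, with both at least 1. These are the cases in which the
    join is unaffected by the choice. *)
Lemma minimal_edge_unique y i y' i' : minimal_edge (y, i) -> minimal_edge (y', i') ->
  [\/ A (y^-1 * y')%g /\ i = i',
      [/\ A (y^-1 * y')%g, U i y <= 0 & U i' y' <= 0]
    | [/\ H i (y^-1 * y')%g, i = i', 1 <= U i y & 1 <= U i' y']].
Proof.
case: (hU) => h1 h2 h3 Gy [/= Gy1 Gy2]; set g := (y^-1 * y')%g.
have y'E : y' = (y * g)%g by rewrite /g mulVKg.
have [Ag|[j gj]] := alternating_total g.
  have [ii'|ii'] := eqVneq i i'; first by constructor 1.
  constructor 2; split => //; first by rewrite -(h1 g) // -y'E; exact: Gy1.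
  by rewrite y'E h1 //; apply: Gy.1 => /=; rewrite eq_sym.
have [Uj Hj] := slope_alternating Gy gj.
have [ji'|/Gy1] := eqVneq j i'; last by rewrite y'E; lra.
subst j; case: Hj => [[Hg nAg]|[h [Hh nAh Uh]]]; last first.
  have := Gy2 h^-1%g (HV Hh); rewrite y'E => /(_ _); have : ~ A h^-1%g.
    by move/AV; rewrite invgK.
  by move=> nA /(_ nA); lra.
have U1 : 1 <= U i' y.
  have : ~ A g^-1%g by move/AV; rewrite invgK.
  by move/(Gy2 _ (HV Hg)); rewrite y'E mulgK.
have [ii'|ii'] := eqVneq i' i; last by have := Gy.1 _ ii'; rewrite /=; lra.
by subst i'; constructor 3; split=> //; rewrite y'E.
Qed.

End Potential.
End Barycenter.

(** * Maps out of geometric realizations *)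

Section RealizationMaps.
Local Open Scope ring_scope.
Local Open Scope quotient_scope.
Variable R : realType.
Notation Delta n := (set_type (@simplex R n)).

Section Simplex.
Variable Z : topologicalType.

Lemma continuous_to_simplex n (f : Z -> Delta n) :
  (forall k, continuous (fun z => \val (f z) 0 k : R)) -> continuous f.
Proof.
move=> fc z V; rewrite nbhsE => -[_ [[B oB <-] Bz] sB].
suff : nbhs z (f @^-1` (\val @^-1` B)) by apply: filterS => w; exact: sB.
have : nbhs (\val (f z) : 'rV[R]_n.+1) B by apply: open_nbhs_nbhs.
case=> P nP sP; rewrite /nbhs/=.
have H : nbhs z [set w | forall k, P 0 k (\val (f w) 0 k)].
  by apply: filter_forall => k; apply: fc; exact: nP.
by apply: filterS H => w Pw; apply: sP => i k; rewrite ord1; exact: Pw.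
Qed.

Lemma simplex_coord_continuous n k : continuous (fun t : Delta n => \val t 0 k : R).
Proof.
move=> t.
apply: (@continuous_comp _ _ _ (\val : Delta n -> 'rV[R]_n.+1) (fun M => M 0 k) t).
  exact: initial_continuous.
exact: coord_continuous.
Qed.
End Simplex.

Variable X : sset.

Definition realization_point n (x : X n) (t : Delta n) : realization R X :=
  \pi_(realization R X) (cell x t).

Lemma realization_pointE m n (f : ordmap m n) (x : X n) (t : Delta m) :
  realization_point (sact f x) t = realization_point x (simplex_push f t).
Proof.
apply/eqquotP/asboolP; exact: realization_glue.
Qed.

Lemma realization_point_continuous n (x : X n) : continuous (realization_point x).
Proof.
move=> t; apply: continuous_comp; last exact: pi_continuous.
exact: existT_continuous.
Qed.

Lemma realization_ind (P : realization R X -> Prop) :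
  (forall n (x : X n) t, P (realization_point x t)) -> forall q, P q.
Proof.
move=> h q; rewrite -(reprK q); case: (repr q) => -[n x] t; exact: h.
Qed.

Section Lift.
Variables (Y : topologicalType) (F : forall n, X n -> Delta n -> Y).
Hypothesis Fnat : forall m n (f : ordmap m n) (x : X n) t,
  F (sact f x) t = F x (simplex_push f t).
Hypothesis Fcont : forall n (x : X n), continuous (F x).

Let Fcell (c : cells R X) : Y := F (tagged (tag c)) (tagged c).

Lemma realization_lift : exists2 f : realization R X -> Y, continuous f &
  forall n (x : X n) t, f (realization_point x t) = F x t.
Proof.
have Feqv a b : realization_eqv a b -> Fcell a = Fcell b.
  by elim=> [//|? ? _ ->//|? ? ? _ -> _ ->//|m n f x t]; exact: Fnat.
have Fpi a b : \pi_(realization R X) a == \pi_(realization R X) b :> realization R X ->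
    Fcell a = Fcell b.
  by move=> /eqP/eqquotP/asboolP/Feqv.
exists (Fcell \o repr).
  apply: repr_comp_continuous; last by move=> a b /Fpi/eqP.
    by move=> [[n x] t] V nV; exact: (Fcont nV).
move=> n x t /=.
have -> : F x t = Fcell (cell x t) by [].
by apply: Fpi; rewrite reprK.
Qed.

End Lift.

(** The product of a quotient map with the locally compact space [R] is again a quotient map. In
    curried form: lift to the compact-open function space, then uncurry. *)
Lemma realization_lift_homotopy (Y : topologicalType)
    (F : forall n, X n -> Delta n * R -> Y) :
  (forall m n (f : ordmap m n) (x : X n) t s,
    F m (sact f x) (t, s) = F n x (simplex_push f t, s)) ->
  (forall n (x : X n), continuous (F n x)) ->
  exists2 h : realization R X * R -> Y, continuous h &
  forall n (x : X n) t s, h (realization_point x t, s) = F n x (t, s).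
Proof.
move=> Fnat Fcont.
pose F' n (x : X n) t : {compact-open, R -> Y} := fun s => F n x (t, s).
have [||h hc hE] := @realization_lift {compact-open, R -> Y} F'.
- by move=> m n f x t; apply/funext => s; exact: Fnat.
- move=> n x; exact: (continuous_curry_fun (@Fcont n x)).
exists (fun p => h p.1 p.2); last by move=> n x t s; rewrite hE.
have := @continuous_uncurry (realization R X) R Y h (@locally_compactR R)
  (@Rhausdorff R) hc.
have -> : (fun p => h p.1 p.2) = uncurry h by apply/funext => -[].
apply; elim/realization_ind => n x t; rewrite hE /F'.
have [_] := continuous_curry (@Fcont n x); exact.
Qed.

End RealizationMaps.

(** * Joins of copies of a simplex *)

Section Pasting.
Variables (Z Y : topologicalType) (E : eqType).

(** Near [z0], a closed piece missing [z0] is avoided altogether, and on each remaining piece [psi]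
    is a [phi e] continuous at [z0]. Finiteness lets these neighbourhoods be intersected. *)
Lemma continuous_paste_finite (F : seq E) (W : E -> set Z) (phi : E -> Z -> Y)
    (psi : Z -> Y) :
  (forall e, e \in F -> closed (W e)) ->
  (forall e, e \in F -> continuous (phi e)) ->
  (forall z, exists2 e, e \in F & W e z) ->
  (forall e z, e \in F -> W e z -> psi z = phi e z) ->
  continuous psi.
Proof.
move=> Wcl phic cover psiE z0 V nV.
suff : nbhs z0 [set z | forall e, e \in F -> W e z -> V (phi e z)].
  apply: filterS => z hz /=; have [e eF We] := cover z.
  by rewrite (psiE e)//; exact: hz.
have {}nV e : e \in F -> W e z0 -> nbhs (phi e z0) V by move=> eF We; rewrite -(psiE e).
elim: F Wcl phic nV {cover psiE} => [|e F IH] Wcl phic nV.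
  by apply: filterE => z e.
have nF : nbhs z0 [set z | forall e, e \in F -> W e z -> V (phi e z)].
  by apply: IH => e' e'F; [apply: Wcl|apply: phic|apply: nV]; rewrite inE e'F orbT.
have eF : e \in e :: F by rewrite inE eqxx.
have ne : nbhs z0 [set z | W e z -> V (phi e z)].
  case: (pselect (W e z0)) => [We|nWe].
    have : nbhs z0 (phi e @^-1` V) by apply: phic => //; exact: nV.
    by apply: filterS => z Vz _.
  have : nbhs z0 (~` W e) by apply: open_nbhs_nbhs; split=> //; apply/closed_openC/Wcl.
  by apply: filterS => z nW /nW.
apply: filterS2 nF ne => z hF he e'; rewrite inE => /predU1P[->//|]; exact: hF.
Qed.

End Pasting.

Section Blocks.
Local Open Scope ring_scope.
Variable R : realType.
Notation Delta n := (set_type (@simplex R n)).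

Section Index.
Variables B n : nat.

(* The vertices of a join of B + 1 copies of an n-simplex are the pairs of a
   block and a vertex, in lexicographic order. *)
Definition blocks := (B * n.+1 + n)%N.

Lemma block_fst_proof (l : 'I_blocks.+1) : (l %/ n.+1 < B.+1)%N.
Proof. by rewrite ltn_divLR// mulSn addnC addnS; exact: ltn_ord l. Qed.

Lemma block_snd_proof (l : 'I_blocks.+1) : (l %% n.+1 < n.+1)%N.
Proof. exact: ltn_pmod. Qed.

Lemma block_pair_proof (b : 'I_B.+1) (k : 'I_n.+1) : (b * n.+1 + k < blocks.+1)%N.
Proof.
rewrite /blocks ltnS leq_add//; last by rewrite -ltnS.
by rewrite leq_mul2r -ltnS ltn_ord orbT.
Qed.

Definition block_fst l := Ordinal (block_fst_proof l).
Definition block_snd l := Ordinal (block_snd_proof l).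
Definition block_pair b k := Ordinal (block_pair_proof b k).

Lemma block_pairK b k : (block_fst (block_pair b k) = b) * (block_snd (block_pair b k) = k).
Proof.
split; apply: val_inj => /=; first by rewrite divnMDl// divn_small// addn0.
by rewrite modnMDl modn_small.
Qed.

Lemma block_fst_sndK l : block_pair (block_fst l) (block_snd l) = l.
Proof. by apply: val_inj => /=; rewrite -divn_eq. Qed.

Lemma sum_blocks (F : 'I_blocks.+1 -> R) P :
  \sum_(l | P l) F l = \sum_(p | P (block_pair p.1 p.2)) F (block_pair p.1 p.2).
Proof.
rewrite (reindex (fun p : 'I_B.+1 * 'I_n.+1 => block_pair p.1 p.2))//.
exists (fun l => (block_fst l, block_snd l)) => [[b k] _|l _] /=.
  by rewrite !block_pairK.
exact: block_fst_sndK.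
Qed.

Definition block_row (W : 'rV[R]_B.+1) (t : 'rV[R]_n.+1) : 'rV[R]_blocks.+1 :=
  \row_l (W 0 (block_fst l) * t 0 (block_snd l)).

Lemma block_weight_proof (W : Delta B) (t : Delta n) :
  simplex (block_row (\val W) (\val t)).
Proof.
have [W0 W1] := set_mem (valP W); have [t0 t1] := set_mem (valP t).
split=> [l|]; first by rewrite mxE mulr_ge0.
rewrite sum_blocks -(pair_big predT predT (fun b k => block_row _ _ 0 (block_pair b k))) /=.
rewrite -[RHS]W1; apply: eq_bigr => b _; rewrite -[RHS]mulr1 -t1 mulr_sumr.
by apply: eq_bigr => k _; rewrite mxE !block_pairK.
Qed.

Definition block_weight (W : Delta B) (t : Delta n) : Delta blocks :=
  exist _ (block_row (\val W) (\val t)) (mem_set (block_weight_proof W t)).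

End Index.

Lemma lex_block B n (b b' : 'I_B.+1) (k k' : 'I_n.+1) :
  (block_pair b k <= block_pair b' k')%N = (b < b')%N || (b == b') && (k <= k')%N.
Proof.
rewrite /= -val_eqE /=; case: ltngtP => [bb'|bb'|->] /=; last by rewrite leq_add2l.
- have : (b.+1 * n.+1 <= b' * n.+1)%N by rewrite leq_mul2r bb' orbT.
  by rewrite mulSn => h; apply/idP; have := ltn_ord k; lia.
- have : (b'.+1 * n.+1 <= b * n.+1)%N by rewrite leq_mul2r bb' orbT.
  by rewrite mulSn => h; apply/negbTE; have := ltn_ord k'; lia.
Qed.

Section BlockMap.
Variables (B' B n' n : nat) (g : ordmap B' B) (f : ordmap n' n).
Hypothesis g_inj : injective g.

Definition block_map_fun (l : 'I_(blocks B' n').+1) : 'I_(blocks B n).+1 :=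
  block_pair (g (block_fst l)) (f (block_snd l)).

(** Injectivity makes [g] strictly increasing. If two blocks were merged, the order of the second
    coordinates would no longer be controlled. *)
Lemma block_map_proof (l l' : 'I_(blocks B' n').+1) : (l <= l')%N ->
  (block_map_fun l <= block_map_fun l')%N.
Proof.
rewrite /block_map_fun lex_block -{1}(block_fst_sndK l) -{1}(block_fst_sndK l') lex_block.
case/orP=> [bb'|/andP[/eqP-> kk']]; last by rewrite eqxx ordmapP// orbT.
have := ordmapP g (ltnW bb'); rewrite leq_eqVlt => /orP[/eqP/val_inj/g_inj e|h].
  by rewrite e ltnn in bb'.
by rewrite h.
Qed.

Definition block_map : ordmap (blocks B' n') (blocks B n) := OrdMap block_map_proof.

Lemma push_block_weight (W : Delta B') (t : Delta n') :
  simplex_push block_map (block_weight W t) =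
  block_weight (simplex_push g W) (simplex_push f t).
Proof.
apply: val_inj; apply/rowP => l; rewrite !mxE sum_blocks.
rewrite big_distrlr /= pair_big /=; apply: eq_big => -[b k] /=.
  rewrite /block_map_fun !block_pairK; apply/eqP/andP => [<-|[/eqP gb /eqP fk]].
    by rewrite !block_pairK.
  by rewrite gb fk block_fst_sndK.
by move=> _; rewrite mxE !block_pairK.
Qed.

End BlockMap.
End Blocks.

(** * Barycenters *)

Section RealContinuity.
Local Open Scope ring_scope.
Variables (R : realType) (Z : topologicalType).

Lemma continuous_subr_fun (f g : Z -> R) :
  continuous f -> continuous g -> continuous (fun z => f z - g z).
Proof. by move=> fc gc z; apply: cvgB; [exact: fc|exact: gc]. Qed.

Lemma continuous_mulr_fun (f g : Z -> R) :
  continuous f -> continuous g -> continuous (fun z => f z * g z).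
Proof. by move=> fc gc z; apply: cvgM; [exact: fc|exact: gc]. Qed.

Lemma continuous_sum_fun (J : Type) (r : seq J) (F : J -> Z -> R) :
  (forall j, continuous (F j)) -> continuous (fun z => \sum_(j <- r) F j z).
Proof.
move=> Fc; elim: r => [|j r IH].
  by under eq_fun do rewrite big_nil; exact: cst_continuous.
under eq_fun do rewrite big_cons.
by move=> z; apply: cvgD; [exact: Fc|exact: IH].
Qed.

Lemma closed_forall_le (J : Type) (D : J -> Prop) (f g : J -> Z -> R) :
  (forall j, continuous (f j)) -> (forall j, continuous (g j)) ->
  closed [set z | forall j, D j -> f j z <= g j z].
Proof.
move=> fc gc; have -> : [set z | forall j, D j -> f j z <= g j z] =
    \bigcap_(j in D) ((fun z => g j z - f j z) @^-1` [set r | 0 <= r]).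
  by apply/seteqP; split=> z hz j Dj; have := hz j Dj; rewrite /= subr_ge0.
apply: closed_bigI => j _; apply: closed_comp; last exact: closed_ge.
by move=> z _; apply: cvgB; [exact: gc|exact: fc].
Qed.

Definition clamp (r : R) : R := Num.max 0 (Num.min r 1).

Lemma clamp_ge0 r : 0 <= clamp r.
Proof. by rewrite le_max lexx. Qed.
Lemma clamp_le1 r : clamp r <= 1.
Proof. by rewrite ge_max ler01 ge_min lexx orbT. Qed.
Lemma clamp_le0 r : r <= 0 -> clamp r = 0.
Proof. by move=> r0; apply/max_idPl; rewrite ge_min r0. Qed.
Lemma clamp_ge1 r : 1 <= r -> clamp r = 1.
Proof. by move=> r1; rewrite /clamp (min_idPr _)// (max_idPr _). Qed.
Lemma clamp1 : clamp 1 = 1.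
Proof. exact: clamp_ge1. Qed.

Lemma continuous_clamp (f : Z -> R) : continuous f -> continuous (fun z => clamp (f z)).
Proof.
move=> fc z; apply: (@continuous_max _ _ (fun=> 0) (fun z => Num.min (f z) 1)).
  exact: cst_continuous.
apply: (@continuous_min _ _ f (fun=> 1)); first exact: fc.
exact: cst_continuous.
Qed.

End RealContinuity.

(** * Signed distances and equivariant projections to cosets *)

Section TreeStructure.
Local Open Scope group_scope.
Variables (K : groupType) (I : choiceType).

(* [s i k] is the signed distance from the vertex A to the vertex kA of the
   Bass-Serre tree, positive when the geodesic starts with the edge from A to
   H_i. *)
Record tree_structure (A : set K) (H : I -> set K) (s : I -> K -> int) : Prop := {
  tree_A1 : A 1;
  tree_AM : forall a b, A a -> A b -> A (a * b);
  tree_AV : forall a, A a -> A a^-1;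
  tree_AH : forall i a, A a -> H i a;
  tree_HM : forall i a b, H i a -> H i b -> H i (a * b);
  tree_HV : forall i a, H i a -> H i a^-1;
  tree_gen : forall P : K -> Prop, P 1 ->
    (forall g i h, P g -> H i h -> P (g * h)) -> forall g, P g;
  tree_fin : exists Hs : seq K, forall i h, H i h -> h \in Hs;
  tree_dist1 : forall i, s i 1 = 0%R;
  tree_distA : forall i a k, A a -> s i (a * k) = s i k;
  tree_dist_neq : forall i j k, i != j -> (s i k + s j k <= 0)%R;
  tree_distH : forall i h k, H i h -> ~ A h -> (2 <= s i k + s i (h * k)%g)%R
}.

(** For [h] outside [A], the path from A to hA starts towards H_i, so every other direction sees hA
    behind it. *)
Lemma tree_distH_neq A H s : tree_structure A H s ->
  forall i j h, H i h -> j != i -> (s j h <= 0)%R.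
Proof.
move=> T i j h Hh ji; case: (pselect (A h)) => [Ah|nAh].
  by rewrite -[h]mulg1 (tree_distA T)// (tree_dist1 T).
have := tree_distH T 1 Hh nAh; rewrite (tree_dist1 T) mulg1.
by have := tree_dist_neq T h ji; lia.
Qed.

(* The choice depends only on the coset x^-1 y S, which makes it equivariant. *)
Definition coset_point (S : set K) (y x : K) : K :=
  x * xget 1 [set g | S ((x^-1 * y)^-1 * g)].

Lemma coset_pointP (S : set K) y x : S 1 -> S (y^-1 * coset_point S y x).
Proof.
move=> S1; rewrite /coset_point.
case: xgetP => [g _ /=|/(_ (x^-1 * y))]; last by rewrite /= mulVg.
by rewrite invgM invgK mulgA.
Qed.

Lemma coset_point_mulr (S : set K) y h : (forall a b, S a -> S b -> S (a * b)) ->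
  S h -> S h^-1 -> coset_point S (y * h) = coset_point S y.
Proof.
move=> SM Sh SVh; apply/funext => x; rewrite /coset_point; congr (_ * xget _ _).
apply/seteqP; split=> g /=; rewrite !invgM !invgK.
  by move=> /(SM _ _ Sh); rewrite !mulgA mulgV mul1g.
by move=> /(SM _ _ SVh); rewrite !mulgA.
Qed.

(** A coset yS alone admits no equivariant choice of a point, being stabilized by a conjugate of S.
    Letting the point depend on [x], on which K acts freely, removes the obstruction. *)
Lemma coset_point_mull (S : set K) c y x :
  coset_point S (c * y) (c * x) = c * coset_point S y x.
Proof.
have e : (c * x)^-1 * (c * y) = x^-1 * y by rewrite invgM -mulgA mulKg.
by rewrite /coset_point e mulgA.
Qed.

End TreeStructure.

Section Slope.
Local Open Scope ring_scope.
Variables (R : realType) (K : groupType) (I : choiceType).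
Variables (A : set K) (H : I -> set K) (s : I -> K -> int).
Hypothesis T : tree_structure A H s.
Notation Delta n := (set_type (@simplex R n)).

Definition slope n (x : 'I_n.+1 -> K) (t : 'rV[R]_n.+1) (i : I) (y : K) : R :=
  \sum_k t 0 k * (s i (y^-1 * x k)%g)%:~R.

Lemma slope_convex n (x : 'I_n.+1 -> K) t : simplex t -> convex_slopes A H (slope x t).
Proof.
case=> t0 t1; split.
- move=> a y i Aa; apply: eq_bigr => k _; rewrite invgM -mulgA.
  by rewrite (tree_distA T)//; apply: (tree_AV T).
- move=> i j y ij; rewrite -big_split /= sumr_le0// => k _.
  by rewrite -mulrDr -intrD mulr_ge0_le0// lerz0; apply: tree_dist_neq T _ _ _ ij.
- move=> i h y Hh nAh; rewrite -big_split /=.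
  have -> : 2 = \sum_k t 0 k * 2 :> R by rewrite -mulr_suml t1 mul1r.
  apply: ler_sum => k _; rewrite -mulrDr ler_wpM2l// -intrD -[2]/(2%:~R) ler_int.
  have := tree_distH T (h^-1 * (y^-1 * x k))%g Hh nAh.
  by rewrite mulVKg addrC invgM -mulgA.
Qed.

Lemma slope_push m n (f : ordmap m n) (x : 'I_n.+1 -> K) t i y :
  slope (x \o f) t i y = slope x (simplex_pushforward f t) i y.
Proof.
rewrite /slope (partition_big f predT)//=; apply: eq_bigr => j _.
by rewrite mxE mulr_suml; apply: eq_bigr => k /eqP <-.
Qed.

Lemma slope_mull n (x : 'I_n.+1 -> K) t i c y :
  slope (fun k => c * x k)%g t i (c * y)%g = slope x t i y.
Proof. by apply: eq_bigr => k _; rewrite invgM -!mulgA mulKg. Qed.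

Lemma slope_continuous n (x : 'I_n.+1 -> K) i y :
  continuous (fun z : Delta n * R => slope x (\val z.1) i y).
Proof.
apply: continuous_sum_fun => k z.
apply: cvgM; last exact: cvg_cst.
apply: (@continuous_comp _ _ _ fst (fun t : Delta n => \val t 0 k : R) z).
  exact: cvg_fst.
exact: simplex_coord_continuous.
Qed.

Lemma closed_minimal_edge n (x : 'I_n.+1 -> K) e :
  closed [set z : Delta n * R | minimal_edge A H (slope x (\val z.1)) e].
Proof.
have -> : [set z : Delta n * R | minimal_edge A H (slope x (\val z.1)) e] =
    [set z | forall j, j != e.2 -> slope x (\val z.1) j e.1 <= 0] `&`
    [set z | forall h, (H e.2 h /\ ~ A h) -> 1 <= slope x (\val z.1) e.2 (e.1 * h)%g].
  apply/seteqP; split=> z [h1 h2]; split=> //= h; first by case; exact: h2.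
  by move=> *; apply: h2.
apply: closedI.
  apply: (@closed_forall_le R _ I (fun j => j != e.2)
    (fun j (z : Delta n * R) => slope x (\val z.1) j e.1) (fun=> fun=> 0)) => j.
    exact: slope_continuous.
  exact: cst_continuous.
apply: (@closed_forall_le R _ K (fun h => H e.2 h /\ ~ A h)
  (fun=> fun=> 1) (fun h (z : Delta n * R) => slope x (\val z.1) e.2 (e.1 * h)%g)) => h.
  exact: cst_continuous.
exact: slope_continuous.
Qed.

Lemma slope_bound n (x : 'I_n.+1 -> K) t i (N : nat) : simplex t ->
  (forall k, s i (x k) <= 2 * N%:Z) -> slope x t i 1%g <= 2 * N%:R.
Proof.
move=> [t0 t1] sN; have -> : 2 * N%:R = \sum_k t 0 k * (2 * N%:R) :> R.
  by rewrite -mulr_suml t1 mul1r.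
apply: ler_sum => k _; rewrite ler_wpM2l// invg1 mul1g.
by rewrite (_ : 2 * N%:R = (2 * N%:Z)%:~R) ?ler_int// intrM.
Qed.

End Slope.

(** * Weights of the joins *)

Section Selection.
Local Open Scope ring_scope.
Variables (R : realType) (K : groupType).
Notation Delta n := (set_type (@simplex R n)).

Lemma simplex_push_id n (t : Delta n) : simplex_push (ordmap_id n) t = t.
Proof.
by apply: val_inj; apply/rowP => k; rewrite mxE /= (big_pred1 k).
Qed.

(* [cls n z t] is the point with coordinates t of the simplex with vertices z, up
   to left translation of z; V tells which sequences span a simplex. *)
Record simplex_classes (Y : topologicalType)
    (V : forall n, ('I_n.+1 -> K) -> Prop)
    (cls : forall n, ('I_n.+1 -> K) -> Delta n -> Y) : Prop := {
  cls_cont : forall n (z : 'I_n.+1 -> K), V n z -> continuous (cls n z);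
  cls_glue : forall m n (f : ordmap m n) (z : 'I_n.+1 -> K) t, V n z ->
    cls m (z \o f) t = cls n z (simplex_push f t);
  cls_mull : forall n c (z : 'I_n.+1 -> K), cls n (fun k => c * z k)%g = cls n z;
  cls_valid_glue : forall m n (f : ordmap m n) (z : 'I_n.+1 -> K),
    V n z -> V m (z \o f);
  cls_valid_mull : forall n c (z : 'I_n.+1 -> K), V n z -> V n (fun k => c * z k)%g
}.

Definition block_seq B n (Q : nat -> K -> K) (x : 'I_n.+1 -> K) :
    'I_(blocks B n).+1 -> K := fun l => Q (block_fst l) (x (block_snd l)).

Section Weights.
Variable p : bool.

(** The flag [p] adds the original simplex as block 0, with weight decreasing from 1 to 0 in the
    time [v]: [true] gives the homotopy, [false] the retraction, which ignores [v]. Clamping makes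
    the formula meaningful for all real times and slopes. *)
Definition join_row (v u : R) : 'rV[R]_p.+2 :=
  let v' := if p then clamp v else 1 in
  \row_b (if b == p.+1 :> nat then v' * clamp u
          else if b == p :> nat then v' * (1 - clamp u) else 1 - v').

Definition vertex_row (v : R) : 'rV[R]_p.+1 :=
  let v' := if p then clamp v else 1 in
  \row_b (if b == p :> nat then v' else 1 - v').

Lemma join_row_simplex v u : simplex (join_row v u).
Proof.
have v0 := clamp_ge0 v; have v1 := clamp_le1 v.
have u0 := clamp_ge0 u; have u1 := clamp_le1 u.
split=> [b|].
  rewrite mxE; set v' := if p then _ else _.
  have [v'0 v'1] : 0 <= v' /\ v' <= 1 by rewrite /v'; case: (p); split.
  by case: ifP => _; [|case: ifP => _]; rewrite ?mulr_ge0 ?subr_ge0.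
rewrite /join_row; case: (p) => /=; rewrite !big_ord_recl big_ord0 !mxE /= ?addr0; by ring.
Qed.

Lemma vertex_row_simplex v : simplex (vertex_row v).
Proof.
have v0 := clamp_ge0 v; have v1 := clamp_le1 v.
split=> [b|].
  by rewrite mxE; case: ifP => _; case: (p); rewrite ?subr_ge0.
rewrite /vertex_row; case: (p) => /=; rewrite !big_ord_recl big_ord0 !mxE /= ?addr0; by ring.
Qed.

Definition join_weight v u : Delta p.+1 :=
  exist _ (join_row v u) (mem_set (join_row_simplex v u)).
Definition vertex_weight v : Delta p :=
  exist _ (vertex_row v) (mem_set (vertex_row_simplex v)).

(** [skip_D] omits the block of projections to the coset of A, and [skip_C] below omits that of
    projections to the coset of H_i. *)
Definition skip_D_fun (b : 'I_p.+1) : 'I_p.+2 :=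
  if b == p :> nat then ord_max else widen_ord (leqnSn _) b.
Lemma skip_D_proof (b b' : 'I_p.+1) : (b <= b')%N -> (skip_D_fun b <= skip_D_fun b')%N.
Proof.
rewrite /skip_D_fun => bb'; have := ltn_ord b; have := ltn_ord b'.
by case: eqP => h; case: eqP => h' /=; lia.
Qed.
Definition skip_D := OrdMap skip_D_proof.
Lemma skip_D_inj : injective skip_D.
Proof.
move=> b b' /(congr1 val) /=; rewrite /skip_D_fun => h; apply: val_inj => /=; move: h.
have := ltn_ord b; have := ltn_ord b'.
by case: eqP => h; case: eqP => h' /=; lia.
Qed.

Definition skip_C : ordmap p p.+1 := @OrdMap p p.+1 (widen_ord (leqnSn _)) (fun b b' h => h).
Lemma skip_C_inj : injective skip_C.
Proof. by move=> b b' /(congr1 val) /= h; apply: val_inj. Qed.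

Lemma push_skip_C v u : u <= 0 -> simplex_push skip_C (vertex_weight v) = join_weight v u.
Proof.
move=> u0; apply: val_inj; apply/rowP => b; rewrite /join_row !mxE (clamp_le0 u0) subr0 mulr0 mulr1.
have [bp|bp] := eqVneq (b : nat) p.+1.
  rewrite big_pred0// => j; apply/negbTE; rewrite -val_eqE /= bp.
  by have := ltn_ord j; lia.
have bp1 : (b < p.+1)%N by have := ltn_ord b; lia.
by rewrite (big_pred1 (Ordinal bp1)) ?mxE.
Qed.

Lemma push_skip_D v u : 1 <= u -> simplex_push skip_D (vertex_weight v) = join_weight v u.
Proof.
move=> u1; apply: val_inj; apply/rowP => b; rewrite /join_row !mxE (clamp_ge1 u1) subrr mulr0 mulr1.
have [bp|bp] := eqVneq (b : nat) p.+1.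
  rewrite (big_pred1 ord_max) ?mxE /= ?eqxx// => j.
  rewrite /= -[LHS]val_eqE -[RHS]val_eqE /= /skip_D_fun bp; have := ltn_ord j.
  by case: (eqVneq (j : nat) p) => h /=; lia.
have [bp'|bp'] := eqVneq (b : nat) p.
  rewrite big_pred0// => j; apply/negbTE; rewrite -val_eqE /= /skip_D_fun bp'.
  by case: (eqVneq (j : nat) p) => h /=; lia.
have bp1 : (b < p.+1)%N by have := ltn_ord b; lia.
rewrite (big_pred1 (Ordinal bp1)) ?mxE /= ?(negbTE bp')// => j.
rewrite /= -[LHS]val_eqE -[RHS]val_eqE /= /skip_D_fun; have := ltn_ord j; have := ltn_ord b.
by case: (eqVneq (j : nat) p) => h /=; lia.
Qed.

Lemma join_row_continuous (Z : topologicalType) (v u : Z -> R) b :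
  continuous v -> continuous u -> continuous (fun z => join_row (v z) (u z) 0 b).
Proof.
move=> vc uc; rewrite /join_row.
have cc : continuous (fun z => clamp (u z)) by exact: continuous_clamp.
have v'c : continuous (fun z => if p then clamp (v z) else 1).
  by case: (p); [exact: continuous_clamp|exact: cst_continuous].
under eq_fun do rewrite mxE.
have c1 : continuous ((fun=> 1) : Z -> R) by exact: cst_continuous.
case: (b == p.+1 :> nat); first exact: continuous_mulr_fun.
case: (b == p :> nat); last exact: continuous_subr_fun.
by apply: continuous_mulr_fun => //; exact: continuous_subr_fun.
Qed.

End Weights.

Lemma lift0_mono n (b b' : 'I_n.+1) : (b <= b')%N -> (lift ord0 b <= lift ord0 b')%N.
Proof. by move=> bb'; rewrite /= /bump /= !add1n ltnS. Qed.
Definition skip_first n : ordmap n n.+1 := OrdMap (@lift0_mono n).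

Lemma skip_first_inj n : injective (@skip_first n).
Proof. by move=> b b' /= /lift_inj. Qed.

Lemma push_skip_first v u :
  simplex_push (skip_first 1) (join_weight false v u) = join_weight true 1 u.
Proof.
apply: val_inj; apply/rowP => b; rewrite /join_row !mxE clamp1 subrr.
case: b => -[|[|[|//]]] hb.
- by rewrite big_pred0.
- by rewrite (big_pred1 ord0) ?mxE.
- by rewrite (big_pred1 ord_max) ?mxE// => j; rewrite /= -[LHS]val_eqE -[RHS]val_eqE.
Qed.

Definition first_block n : ordmap 0 n := @OrdMap 0 n (fun=> ord0) (fun _ _ _ => leqnn _).

Lemma push_first_block v u : v <= 0 ->
  simplex_push (first_block 2) (vertex_weight false 0) = join_weight true v u.
Proof.
move=> v0; apply: val_inj; apply/rowP => b; rewrite /join_row !mxE (clamp_le0 v0) !mul0r subr0.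
case: b => -[|[|[|//]]] hb /=.
- rewrite (big_pred1 ord0) ?mxE//=; last by case=> -[].
- by rewrite big_pred0.
- by rewrite big_pred0.
Qed.

End Selection.

(** * Joins along a minimal edge *)

Section JoinPoint.
Local Open Scope ring_scope.
Variables (R : realType) (K : groupType) (I : choiceType).
Variables (A : set K) (H : I -> set K) (s : I -> K -> int).
Hypothesis T : tree_structure A H s.
Variable i0 : I.
Notation Delta n := (set_type (@simplex R n)).
Variables (Y : topologicalType) (V : forall n, ('I_n.+1 -> K) -> Prop).
Variable (cls : forall n, ('I_n.+1 -> K) -> Delta n -> Y).
Hypothesis hC : simplex_classes V cls.

Lemma block_seq_map B' B n' n (g : ordmap B' B) (f : ordmap n' n)
    (Q' Q : nat -> K -> K) (x : 'I_n.+1 -> K) (g_inj : injective g) :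
  (forall b : 'I_B'.+1, Q' b = Q (g b)) ->
  block_seq Q x \o block_map f g_inj = block_seq Q' (x \o f).
Proof.
move=> QE; apply/funext => l; rewrite [RHS]/block_seq QE.
transitivity (block_seq Q x (block_pair (g (block_fst l)) (f (block_snd l)))) => //.
by rewrite /block_seq !block_pairK.
Qed.

Lemma cls_block_map B' B n' n (g : ordmap B' B) (f : ordmap n' n)
    (Q' Q : nat -> K -> K) (x : 'I_n.+1 -> K) (W : Delta B') (t : Delta n') :
  injective g -> V (block_seq (B := B) Q x) ->
  (forall b : 'I_B'.+1, Q' b = Q (g b)) ->
  cls (block_seq (B := B') Q' (x \o f)) (block_weight W t) =
  cls (block_seq (B := B) Q x) (block_weight (simplex_push g W) (simplex_push f t)).
Proof.
move=> g_inj Vx QE; rewrite -(push_block_weight _ g_inj) -(cls_glue hC)//.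
by rewrite (block_seq_map _ _ _ QE).
Qed.

Section Edge.
Variables (p : bool) (n : nat).
Implicit Types (e : K * I) (x : 'I_n.+1 -> K) (z : Delta n * R).

Definition join_key e (b : nat) : K -> K :=
  if b == p.+1 then coset_point (H e.2) e.1
  else if b == p then coset_point A e.1 else id.

Definition vertex_key (S : set K) y (b : nat) : K -> K :=
  if b == p then coset_point S y else id.

Definition join_valid e x := V (block_seq (B := p.+1) (join_key e) x).

(* The join of (the simplex x, if p holds, and) its projections to the coset yA
   and to the coset yH_i, for e = (y, i). *)
Definition join_point e x z : Y :=
  cls (block_seq (B := p.+1) (join_key e) x)
    (block_weight (join_weight p z.2 (slope s x (\val z.1) e.2 e.1)) z.1).

Lemma join_point_D e x z : join_valid e x -> slope s x (\val z.1) e.2 e.1 <= 0 ->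
  join_point e x z = cls (block_seq (B := p) (vertex_key A e.1) x)
    (block_weight (vertex_weight p z.2) z.1).
Proof.
move=> Vx u0; rewrite /join_point -(push_skip_C _ _ u0) -[z.1 in LHS]simplex_push_id.
rewrite -(cls_block_map (Q' := vertex_key A e.1) _ _ _ (@skip_C_inj p) Vx)// => b.
by rewrite /vertex_key /join_key /= (ltn_eqF (ltn_ord b)).
Qed.

Lemma join_point_C e x z : join_valid e x -> 1 <= slope s x (\val z.1) e.2 e.1 ->
  join_point e x z = cls (block_seq (B := p) (vertex_key (H e.2) e.1) x)
    (block_weight (vertex_weight p z.2) z.1).
Proof.
move=> Vx u1; rewrite /join_point -(push_skip_D _ _ u1) -[z.1 in LHS]simplex_push_id.
rewrite -(cls_block_map (Q' := vertex_key (H e.2) e.1) _ _ _ (@skip_D_inj p) Vx)// => b.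
rewrite /vertex_key /join_key /= /skip_D_fun; have := ltn_ord b.
case: (eqVneq (b : nat) p) => /= [->|hb] b1; first by rewrite eqxx.
by case: eqP => [h|_]; [lia|rewrite (negbTE hb)].
Qed.

(** In each case of [minimal_edge_unique] the blocks of nonzero weight depend only on the coset
    shared by the two edges. *)
Lemma join_point_unique e e' x z :
  minimal_edge A H (slope s x (\val z.1)) e -> minimal_edge A H (slope s x (\val z.1)) e' ->
  join_valid e x -> join_valid e' x -> join_point e x z = join_point e' x z.
Proof.
case: e e' => [y i] [y' i'] Ge Ge' Ve Ve'.
have U := slope_convex T x (set_mem (valP z.1)).
have [U1 _ _] := U.
have y'E : y' = (y * (y^-1 * y'))%g by rewrite mulVKg.
have AM := @tree_AM _ _ _ _ _ T; have AV := @tree_AV _ _ _ _ _ T.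
have HM := @tree_HM _ _ _ _ _ T; have HV := @tree_HV _ _ _ _ _ T.
have [[Ag ii']|[Ag u0 u0']|[Hg ii' u1 u1']] :=
    minimal_edge_unique AM AV (tree_A1 T) (@tree_AH _ _ _ _ _ T) HM HV (@tree_gen _ _ _ _ _ T)
      U Ge Ge'.
- subst i'; rewrite /join_point /join_key /= y'E U1//.
  rewrite !coset_point_mulr//; first exact: AV.
  + exact: HM.
  + exact: (tree_AH T).
  + by apply/HV/(tree_AH T).
- rewrite !join_point_D//= y'E /vertex_key coset_point_mulr//; exact: AV.
- subst i'; rewrite !join_point_C//= y'E /vertex_key coset_point_mulr//.
    exact: HM.
  exact: HV.
Qed.

Lemma join_point_continuous e x : join_valid e x -> continuous (join_point e x).
Proof.
move=> Vx z; apply: (@continuous_comp _ _ _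
  (fun z : Delta n * R => block_weight (join_weight p z.2 (slope s x (\val z.1) e.2 e.1)) z.1)
  (cls (block_seq (B := p.+1) (join_key e) x))); last exact: (cls_cont hC).
move: z; apply: continuous_to_simplex => k.
rewrite /=; under eq_fun do rewrite mxE.
apply: continuous_mulr_fun.
  apply: join_row_continuous; first by move=> z; exact: cvg_snd.
  exact: slope_continuous.
move=> z; apply: (@continuous_comp _ _ _ fst (fun t : Delta n => \val t 0 (block_snd k) : R) z).
  exact: cvg_fst.
exact: simplex_coord_continuous.
Qed.

Lemma join_key_mull c e k b : join_key ((c * e.1)%g, e.2) b (c * k)%g = (c * join_key e b k)%g.
Proof.
rewrite /join_key /=; case: (b == p.+1); first exact: coset_point_mull.
by case: (b == p :> nat); rewrite ?coset_point_mull.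
Qed.

Lemma join_valid_mull c e x : join_valid e x ->
  join_valid ((c * e.1)%g, e.2) (fun k => c * x k)%g.
Proof.
move=> /(cls_valid_mull hC c); rewrite /join_valid.
congr (V _); apply/funext => l; rewrite /block_seq join_key_mull//.
Qed.

Lemma join_point_mull c e x z :
  join_point ((c * e.1)%g, e.2) (fun k => c * x k)%g z = join_point e x z.
Proof.
rewrite /join_point slope_mull -[in RHS](cls_mull hC c); congr (cls _ _).
by apply/funext => l; rewrite /block_seq join_key_mull.
Qed.

Lemma minimal_edge_mull c e x (t : 'rV[R]_n.+1) : minimal_edge A H (slope s x t) e ->
  minimal_edge A H (slope s (fun k => c * x k)%g t) ((c * e.1)%g, e.2).
Proof.
move=> [G1 G2]; split=> /= [j ji|h Hh nAh]; rewrite -?mulgA slope_mull; first exact: G1.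
exact: G2.
Qed.

(** Minimality alone does not suffice: when the barycenter is a vertex, some minimal edges may give
    blocks that do not span a simplex. The default [(1%g, i0)] is never taken when [x] is
    [selectable] and [t] lies in the simplex. *)
Definition selected_edge x (t : 'rV[R]_n.+1) : K * I :=
  xget (1%g, i0) [set e | minimal_edge A H (slope s x t) e /\ join_valid e x].

Definition selected_point x z : Y := join_point (selected_edge x (\val z.1)) x z.

Lemma selected_pointE e x z :
  minimal_edge A H (slope s x (\val z.1)) e -> join_valid e x ->
  selected_point x z = join_point e x z.
Proof.
move=> Ge Ve; rewrite /selected_point /selected_edge.
case: xgetP => [e' _ [Ge' Ve']|/(_ e)[]]; last by split.
exact: join_point_unique.
Qed.

(** One list [F] serves all [t]; this uniformity is what finite pasting needs. *)
Definition selectable x := exists F : seq (K * I), forall t : 'rV[R]_n.+1, simplex t ->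
  exists2 e, e \in F & minimal_edge A H (slope s x t) e /\ join_valid e x.

Lemma selected_point_continuous x : selectable x -> continuous (selected_point x).
Proof.
move=> [F FP].
pose F' := [seq e <- F | `[< join_valid e x >]].
apply: (@continuous_paste_finite _ _ _ F'
  (fun e => [set z : Delta n * R | minimal_edge A H (slope s x (\val z.1)) e])
  (fun e => join_point e x)).
- by move=> e _; exact: closed_minimal_edge.
- by move=> e; rewrite mem_filter => /andP[/asboolP Ve _]; exact: join_point_continuous.
- move=> z; have [e eF [Ge Ve]] := FP _ (set_mem (valP z.1)).
  by exists e => //; rewrite mem_filter eF andbT; apply/asboolP.
- move=> e z; rewrite mem_filter => /andP[/asboolP Ve _] Ge; exact: selected_pointE.
Qed.

Lemma selected_point_mull c x z : selectable x ->
  selected_point (fun k => c * x k)%g z = selected_point x z.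
Proof.
move=> [F FP]; have [e _ [Ge Ve]] := FP _ (set_mem (valP z.1)).
rewrite (selected_pointE Ge Ve) -(join_point_mull c).
by apply: selected_pointE; [exact: minimal_edge_mull|exact: join_valid_mull].
Qed.

End Edge.

(** Slopes see only the total mass at each vertex, so an edge minimal for the pushed forward weights
    is minimal for the pulled back sequence. *)
Lemma selected_point_comp p m n (f : ordmap m n) (x : 'I_n.+1 -> K) t v :
  selectable p x ->
  selected_point p (x \o f) (t, v) = selected_point p x (simplex_push f t, v).
Proof.
move=> [F FP].
have [e _ [Ge Ve]] := FP _ (set_mem (valP (simplex_push f t))).
rewrite (@selected_pointE p n e x (simplex_push f t, v))//.
have idE u : simplex_push (ordmap_id p.+1) (join_weight p v u) = join_weight p v u.
  by rewrite simplex_push_id.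
have id_inj : injective (ordmap_id p.+1) by exact: inj_id.
have slopeE : slope s (x \o f) (\val t) = slope s x (\val (simplex_push f t)).
  by apply/funext => i; apply/funext => y; exact: slope_push.
rewrite (@selected_pointE p m e (x \o f) (t, v)).
- rewrite /join_point /= -[in RHS]idE -(cls_block_map (Q' := join_key p e) _ _ _ id_inj Ve)//.
  by rewrite slope_push.
- by rewrite slopeE.
- have := cls_valid_glue hC (block_map f id_inj) Ve.
  by rewrite (@block_seq_map _ _ _ _ _ _ (join_key p e)).
Qed.

(* At the end of the homotopy, the first block has weight 0. *)
Lemma join_point_end n e (x : 'I_n.+1 -> K) (t : Delta n) v :
  join_valid true e x -> join_point true e x (t, 1) = join_point false e x (t, v).
Proof.
move=> Ve; rewrite /join_point /=.
rewrite -(push_skip_first v) -[t in LHS]simplex_push_id.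
rewrite -(cls_block_map (Q' := join_key false e) _ _ _ (@skip_first_inj 1) Ve)//.
by rewrite simplex_push_id.
Qed.

Lemma join_point_start n e (x : 'I_n.+1 -> K) (t : Delta n) :
  join_valid true e x -> join_point true e x (t, 0) = cls x t.
Proof.
move=> Ve; rewrite /join_point /=.
rewrite -(@push_first_block R 0)// -[t in LHS]simplex_push_id.
have g_inj : injective (first_block 2) by move=> b b' _; rewrite [b]ord1 [b']ord1.
rewrite -(cls_block_map (Q' := fun=> id) _ _ _ g_inj Ve)//.
(* A join with a single block is the simplex itself; [d] is this identification. *)
pose d : ordmap n (blocks 0 n) :=
  @OrdMap n (blocks 0 n) (fun k => block_pair ord0 k) (fun k k' h => h).
have dE : block_seq (B := 0) (fun=> id) x \o d = x.
  by apply/funext => k; rewrite /block_seq /= !block_pairK.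
rewrite -[in RHS]dE (cls_glue hC); last first.
  have := cls_valid_glue hC (block_map (ordmap_id n) g_inj) Ve.
  by rewrite (@block_seq_map _ _ _ _ _ _ (fun=> id)).
congr (cls _ _).
apply: val_inj; apply/rowP => l; rewrite !mxE.
rewrite (big_pred1 (block_snd l)) => [|k].
  by rewrite [block_fst l]ord1 mul1r.
rewrite /= -[l in LHS]block_fst_sndK [block_fst l]ord1.
apply/eqP/eqP => [/(congr1 (@block_snd _ _))|->//].
by rewrite !block_pairK.
Qed.

End JoinPoint.

(** * The retraction of the classifying space *)

Lemma continuous_pair_fun (X Y Z : topologicalType) (f : X -> Y) (g : X -> Z) :
  continuous f -> continuous g -> continuous (fun x => (f x, g x)).
Proof.
move=> fc gc x.
by apply: (@cvg_pair _ _ _ (nbhs x) (nbhs (f x)) (nbhs (g x)) _ _ _ f g);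
  [exact: fc|exact: gc].
Qed.

Lemma continuous_pairl (X Y Z : topologicalType) (f : X * Y -> Z) (y : Y) :
  continuous f -> continuous (fun x => f (x, y)).
Proof.
move=> fc x; apply: (@continuous_comp _ _ _ (fun x => (x, y)) f x); last exact: fc.
move: x; apply: continuous_pair_fun; last exact: cst_continuous.
by move=> x; exact: cvg_id.
Qed.

(** * Homogeneous coordinates on the nerve *)

Section Jumps.
Local Open Scope group_scope.
Variable K : groupType.

(** From homogeneous coordinates to bar notation. The fibres are the orbits of left translation, and
    [partial_products] picks the sequence starting at 1. *)
Definition jump n (z : 'I_n.+1 -> K) : {ffun 'I_n -> K} :=
  [ffun k => (z (widen_ord (leqnSn n) k))^-1 * z (lift ord0 k)].

Definition partial_products n (g : {ffun 'I_n -> K}) (k : 'I_n.+1) : K :=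
  \prod_(j < n | 0 <= j < k) g j.

Lemma prod_jump n (z : 'I_n.+1 -> K) (a b : nat) : a <= b <= n ->
  \prod_(j < n | a <= j < b) jump z j = (z (inord a))^-1 * z (inord b).
Proof.
case/andP=> ab; elim: b ab => [|b IH].
  rewrite leqn0 => /eqP-> _; rewrite mulVg big_pred0//.
rewrite leq_eqVlt => /predU1P[<- _|]; last first.
  rewrite ltnS => ab bn; rewrite -(@prod_interval_cat _ _ _ a b b.+1) ?ab ?leqnSn//.
  rewrite IH// 1?ltnW// (big_pred1 (Ordinal bn)); last first.
    by move=> j /=; rewrite -val_eqE /= ltnS eqn_leq andbC.
  rewrite ffunE -mulgA; congr (_ * _).
  have -> : widen_ord (leqnSn n) (Ordinal bn) = inord b.
    by apply: val_inj; rewrite /= inordK// ltnS ltnW.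
  have -> : lift ord0 (Ordinal bn) = inord b.+1 by apply: val_inj; rewrite /= inordK.
  by rewrite mulVKg.
by rewrite mulVg big_pred0// => j; rewrite leqNgt andNb.
Qed.

Lemma nerve_act_jump m n (f : ordmap m n) (z : 'I_n.+1 -> K) :
  nerve_act f (jump z) = jump (z \o f).
Proof.
apply/ffunP=> k; rewrite !ffunE prod_jump ?inord_val//.
apply/andP; split; last by rewrite -ltnS.
apply: ordmapP.
by rewrite /= /bump /= add1n.
Qed.

Lemma jump_mull n c (z : 'I_n.+1 -> K) : jump (fun k => c * z k) = jump z.
Proof. by apply/ffunP => k; rewrite !ffunE invgM -mulgA mulKg. Qed.

Lemma jump_partial_products n (g : {ffun 'I_n -> K}) : jump (partial_products g) = g.
Proof.
apply/ffunP => k; rewrite ffunE /partial_products.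
rewrite -(@prod_interval_cat _ _ _ 0 k (lift ord0 k)) /= ?/bump /= ?add1n ?leqnSn//.
rewrite mulKg (big_pred1 k)// => j /=.
by rewrite ltnS -val_eqE eqn_leq andbC.
Qed.

Lemma partial_products_jump n (z : 'I_n.+1 -> K) :
  z = fun k => z ord0 * partial_products (jump z) k.
Proof.
apply/funext => k; rewrite /partial_products prod_jump; last exact: (ltn_ord k).
by rewrite inord_val (_ : inord 0 = ord0) ?mulVKg//; apply: val_inj; rewrite /= inordK.
Qed.

Lemma partial_products_act m n (f : ordmap m n) (g : {ffun 'I_n -> K}) :
  partial_products g \o f =
  fun k => partial_products g (f ord0) * partial_products (nerve_act f g) k.
Proof.
by rewrite [LHS]partial_products_jump -nerve_act_jump jump_partial_products.
Qed.

End Jumps.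

(** * The retraction onto a union of nerves *)

Section Whitehead.
Local Open Scope ring_scope.
Variables (R : realType) (K G : groupType) (I : finType).
Variables (A : set K) (H : I -> set K) (s : I -> K -> int).
Hypothesis T : tree_structure A H s.
Variable i0 : I.
Notation Delta n := (set_type (@simplex R n)).
Variables (pi : group_hom K G) (lam : G -> K).
Hypothesis lamK : forall i h, H i h -> lam (pi h) = h.
Variable P : forall n, pred (nerve G n).
Hypothesis Pact : forall m n (f : ordmap m n) (x : nerve G n), P x -> P (sact f x).
Hypothesis PE : forall n (g : nerve G n),
  P g <-> exists i, forall k, exists2 h, H i h & g k = pi h.

Definition nerve_class n (z : 'I_n.+1 -> K) (t : Delta n) : realization R (nerve K) :=
  realization_point (X := nerve K) (jump z : nerve K n) t.

Lemma nerve_classes : simplex_classes (fun _ _ => True) nerve_class.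
Proof.
split=> //.
- by move=> n z _; exact: realization_point_continuous.
- move=> m n f z t _; rewrite /nerve_class -realization_pointE.
  by congr realization_point; rewrite -nerve_act_jump.
- by move=> n c z; apply/funext => t; rewrite /nerve_class jump_mull.
Qed.

Let U := sub_sset Pact.

Definition sub_simplex n (g : nerve G n) (Pg : P g) : U n :=
  exist (fun g : nerve G n => P g) g Pg.

Lemma P0 : P ([ffun=> 1%g] : nerve G 0).
Proof. by apply/PE; exists i0 => -[]. Qed.

Lemma vertex_simplex : simplex (const_mx 1 : 'rV[R]_1).
Proof. by split=> [i|]; rewrite ?big_ord1 mxE. Qed.

Definition base_point : realization R U :=
  realization_point (sub_simplex P0)
    (exist _ (const_mx 1) (mem_set vertex_simplex)).

(** [base_point] is a default for sequences that span no simplex of [U]; under [sub_valid] it does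
    not occur. *)
Definition sub_class n (z : 'I_n.+1 -> K) (t : Delta n) : realization R U :=
  if insub (jump (pi \o z) : nerve G n) is Some u
  then realization_point (X := U) (u : U n) t else base_point.

Definition sub_valid n (z : 'I_n.+1 -> K) : Prop := P (jump (pi \o z) : nerve G n).

Lemma sub_classE n (z : 'I_n.+1 -> K) t (u : U n) : val u = jump (pi \o z) ->
  sub_class z t = realization_point u t.
Proof.
rewrite /sub_class => <-; case: insubP => [v _ /val_inj->//|].
by rewrite (valP u).
Qed.

Lemma sub_classes : simplex_classes sub_valid sub_class.
Proof.
split.
- move=> n z Vz; have -> : sub_class z = realization_point (sub_simplex Vz).
    by apply/funext => t; apply: sub_classE.
  exact: realization_point_continuous.
- move=> m n f z t Vz; rewrite (@sub_classE _ z _ (sub_simplex Vz))//.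
  by rewrite -realization_pointE; apply: sub_classE; rewrite /= nerve_act_jump.
- move=> n c z; apply/funext => t; rewrite /sub_class.
  have -> : pi \o (fun k => c * z k)%g = (fun k => pi c * (pi \o z) k)%g.
    by apply/funext => k; rewrite /= gmulfM.
  by rewrite jump_mull.
- move=> m n f z; rewrite /sub_valid => /(Pact f).
  by rewrite /= nerve_act_jump.
- move=> n c z; rewrite /sub_valid.
  have -> : pi \o (fun k => c * z k)%g = (fun k => pi c * (pi \o z) k)%g.
    by apply/funext => k; rewrite /= gmulfM.
  by rewrite jump_mull.
Qed.

Lemma sub_valid_coset n (z : 'I_n.+1 -> K) i y : (forall k, H i (y^-1 * z k)%g) ->
  forall k, H i (jump z k) /\ jump (pi \o z) k = pi (jump z k).
Proof.
move=> Hz k; rewrite !ffunE /= gmulfM gmulfV; split=> //.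
have := tree_HM T (tree_HV T (Hz (widen_ord (leqnSn n) k))) (Hz (lift ord0 k)).
by rewrite invgM invgK mulgA mulgK.
Qed.

Lemma sub_validP n (z : 'I_n.+1 -> K) i y : (forall k, H i (y^-1 * z k)%g) -> sub_valid z.
Proof.
move=> Hz; apply/PE; exists i => k; have [h1 h2] := sub_valid_coset Hz k.
by exists (jump z k).
Qed.

Lemma tree_H1 i : H i 1%g.
Proof. by apply: (tree_AH T); apply: (tree_A1 T). Qed.

Lemma join_key_coset (p : bool) (e : K * I) (b : nat) x :
  (b == p.+1) || (b == p :> nat) ->
  H e.2 (e.1^-1 * join_key A H p e b x)%g.
Proof.
rewrite /join_key; case: (b == p.+1) => /= [_|->].
  by apply: (coset_pointP (S := H e.2)); exact: tree_H1.
by apply: (tree_AH T); apply: coset_pointP; exact: (tree_A1 T).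
Qed.

Lemma join_key_false (e : K * I) n (x : 'I_n.+1 -> K) l :
  H e.2 (e.1^-1 * block_seq (B := 1) (join_key A H false e) x l)%g.
Proof.
apply: join_key_coset.
by have := ltn_ord (block_fst l); case: (nat_of_ord _) => [|[|]].
Qed.

Lemma join_valid_false (e : K * I) n (x : 'I_n.+1 -> K) :
  join_valid A H sub_valid false e x.
Proof. by apply: sub_validP => l; exact: join_key_false. Qed.

Lemma join_valid_true (e : K * I) n (x : 'I_n.+1 -> K) :
  (forall k, H e.2 (e.1^-1 * x k)%g) -> join_valid A H sub_valid true e x.
Proof.
move=> Hx; apply: (@sub_validP _ _ e.2 e.1) => l; rewrite /block_seq.
case: (boolP ((block_fst l == 2%N :> nat) || (block_fst l == 1%N :> nat))).
  exact: (@join_key_coset true).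
rewrite negb_or => /andP[h1 h2].
by rewrite /join_key (negbTE h1) (negbTE h2); exact: Hx.
Qed.

(** Each [g] has positive signed distance in at most one direction, so a bound uniform in [i]
    exists. *)
Lemma dist_bound n (x : 'I_n.+1 -> K) : exists N : nat, forall i k, s i (x k) <= 2 * N%:Z.
Proof.
have B g : exists N : nat, forall i, s i g <= N%:Z.
  case: (pselect (exists i, 0 < s i g)) => [[i si]|ns]; last first.
    by exists 0%N => i; rewrite leNgt; apply/negP => si; apply: ns; exists i.
  exists `|s i g|%N => j; have [->|ji] := eqVneq j i; first by lia.
  by have := tree_dist_neq T g ji; lia.
pose N k := xget 0%N [set N : nat | forall i, s i (x k) <= N%:Z].
have NP k i : s i (x k) <= (N k)%:Z.
  by rewrite /N; case: xgetP => [m _ /(_ i)//|h]; have [m /h] := B (x k).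
exists (\sum_k N k)%N => i k; apply: (le_trans (NP k i)).
by rewrite (bigD1 k)//=; lia.
Qed.

Lemma selectable_all (Y : topologicalType) (V : forall n, ('I_n.+1 -> K) -> Prop) p n
    (x : 'I_n.+1 -> K) : (forall e, join_valid A H V p e x) ->
  @selectable R K I A H s V p n x.
Proof.
move=> Vx; have [N NP] := dist_bound x; have [Hs HsP] := tree_fin T.
exists [seq (y, i) | y <- word_ball Hs N, i <- enum I] => t ht.
have [|[y i] Ge yN] := @minimal_edge_exists R K I A H _ (slope_convex T x ht) Hs HsP i0 N.
  by move=> i; apply: slope_bound ht _ => k; exact: NP.
exists (y, i) => //.
by apply/allpairsP; exists (y, i); rewrite mem_enum.
Qed.

Lemma partial_products_sub n (u : U n) : exists i,
  (forall k, H i (lam (val u k)) /\ pi (lam (val u k)) = val u k) /\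
  forall k, H i (partial_products [ffun k => lam (val u k)] k).
Proof.
have /PE[i ui] := valP u; exists i.
have h1 k : H i (lam (val u k)) /\ pi (lam (val u k)) = val u k.
  by have [h Hh ->] := ui k; rewrite (lamK Hh).
split=> // k; rewrite /partial_products; elim/big_ind: _ => [|a b|j _].
- exact: tree_H1.
- exact: (tree_HM T).
- by rewrite ffunE; have [] := h1 j.
Qed.

Definition lift_simplex n (u : U n) : {ffun 'I_n -> K} := [ffun k => lam (val u k)].

(** [lam] need not be multiplicative, but the entries of one simplex lie in the image of a single
    H_i, and there it inverts the morphism [pi]. *)
Lemma lift_simplex_act m n (f : ordmap m n) (u : U n) :
  lift_simplex (sact f u) = nerve_act f (lift_simplex u).
Proof.
have [i [ui _]] := partial_products_sub u.
apply/ffunP => k; rewrite !ffunE /=.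
set g := (X in lam X); set h := RHS.
suff [Hh ->] : H i h /\ g = pi h by exact: lamK Hh.
rewrite {}/g {}/h; elim/big_rec2: _ => [|j h g _ [Hh ->]].
  by split; [exact: tree_H1|rewrite gmulf1].
rewrite ffunE; have [Hj e] := ui j; split; first exact: (tree_HM T).
by rewrite gmulfM e.
Qed.

(** The vertices lie in one H_i, so [minimal_edge_in] yields a minimal edge at that vertex of the
    tree; the sequence and both projections then stay in H_i. *)
Lemma selectable_sub n (u : U n) :
  @selectable R K I A H s sub_valid true n (partial_products (lift_simplex u)).
Proof.
have [i [_ Hu]] := partial_products_sub u; have [Hs HsP] := tree_fin T.
exists [seq (h, i) | h <- Hs] => t ht; set x := partial_products _.
have [j ji h Hh|h Hh Ge] := @minimal_edge_in R K I A H (tree_A1 T) (@tree_AH _ _ _ _ _ T)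
  _ (slope_convex T x ht) 1%g i.
  rewrite mul1g; case: ht => t0 _; apply: sumr_le0 => k _.
  rewrite mulr_ge0_le0// lerz0; apply: (tree_distH_neq T) ji.
  by apply: (tree_HM T); [exact: (tree_HV T)|exact: Hu].
rewrite mul1g in Ge; exists (h, i); first by apply/mapP; exists h; rewrite ?(HsP i).
split=> //; apply: join_valid_true => k /=.
by apply: (tree_HM T); [exact: (tree_HV T)|exact: Hu].
Qed.

Lemma jump_lift n (u : U n) : jump (pi \o partial_products (lift_simplex u)) = val u.
Proof.
have [i [ui _]] := partial_products_sub u; apply/ffunP => k.
have := congr1 (fun g : {ffun _} => pi (g k)) (jump_partial_products (lift_simplex u)).
rewrite !ffunE gmulfM gmulfV /= => ->.
by have [] := ui k.
Qed.

(** Restriction along [f] changes the partial products by a left translation, because they are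
    normalized to start at 1; selected points do not see it. *)
Lemma selected_point_act (Y : topologicalType) V cls p m n (f : ordmap m n)
    (g : {ffun 'I_n -> K}) t v :
  @simplex_classes R K Y V cls ->
  @selectable R K I A H s V p n (partial_products g) ->
  @selectable R K I A H s V p m (partial_products (nerve_act f g)) ->
  selected_point A H s i0 V cls p (partial_products (nerve_act f g)) (t, v) =
  selected_point A H s i0 V cls p (partial_products g) (simplex_push f t, v).
Proof.
move=> hC S S'; rewrite -(selected_point_comp T i0 hC)// partial_products_act.
by rewrite (selected_point_mull T i0 hC).
Qed.

Theorem sub_nerve_homotopy_equivalent :
  homotopy_equivalent R (realization R U) (realization R (nerve K)).
Proof.
have hU := sub_classes; have hN := nerve_classes.
have selN p n (x : 'I_n.+1 -> K) : @selectable R K I A H s (fun _ _ => True) p n x.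
  exact: (@selectable_all (realization R U)).
have selU n (x : 'I_n.+1 -> K) : @selectable R K I A H s sub_valid false n x.
  by apply: (@selectable_all (realization R U)) => e; exact: join_valid_false.
have [iota iota_c iotaE] := @realization_lift R U (realization R (nerve K))
  (fun n u t => realization_point (X := nerve K) (lift_simplex u : nerve K n) t)
  (fun m n f u t => etrans
     (congr1 (fun g => realization_point (X := nerve K) (g : nerve K m) t)
       (lift_simplex_act f u))
     (realization_pointE (X := nerve K) f (lift_simplex u : nerve K n) t))
  (fun n u => @realization_point_continuous R (nerve K) n (lift_simplex u : nerve K n)).
(* With the flag [false] the time is irrelevant; it is set to 0. *)
have [Phi Phi_c PhiE] := @realization_lift R (nerve K) (realization R U)
  (fun n g t => selected_point A H s i0 sub_valid sub_class false (partial_products g) (t, 0))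
  (fun m n f g t => selected_point_act t 0 hU (selU _ _) (selU _ _))
  (fun n g => continuous_pairl (y := 0)
     (@selected_point_continuous R K I A H s T i0 _ _ _ hU false n _ (selU _ _))).
have [hK hK_c hKE] := @realization_lift_homotopy R (nerve K) (realization R (nerve K))
  (fun n g => selected_point A H s i0 (fun _ _ => True) nerve_class true (partial_products g))
  (fun m n f g t v => selected_point_act t v hN (selN _ _ _) (selN _ _ _))
  (fun n g => @selected_point_continuous R K I A H s T i0 _ _ _ hN true n _ (selN _ _ _)).
have Snat m n (f : ordmap m n) (u : U n) t v :
    selected_point A H s i0 sub_valid sub_class true
      (partial_products (lift_simplex (sact f u))) (t, v) =
    selected_point A H s i0 sub_valid sub_class true
      (partial_products (lift_simplex u)) (simplex_push f t, v).
  rewrite lift_simplex_act; apply: selected_point_act => //; first exact: selectable_sub.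
  by rewrite -lift_simplex_act; exact: selectable_sub.
have [hS hS_c hSE] := @realization_lift_homotopy R U (realization R U)
  (fun n u => selected_point A H s i0 sub_valid sub_class true
    (partial_products (lift_simplex u))) Snat
  (fun n u => @selected_point_continuous R K I A H s T i0 _ _ _ hU true n _ (selectable_sub u)).
(* [hS] and [hK] run from the identity to the composite, so time is reversed to match
   [homotopic]. *)
have rev_c (X : topologicalType) : continuous (fun q : X * R => (q.1, 1 - q.2)).
  apply: continuous_pair_fun; first by move=> q; exact: cvg_fst.
  by apply: continuous_subr_fun => q; [exact: cvg_cst|exact: cvg_snd].
exists iota, Phi; split=> //.
- exists (fun q => hS (q.1, 1 - q.2)); split.
  + apply: continuous_subspaceT => q; apply: continuous_comp; [exact: rev_c|exact: hS_c].
  + elim/realization_ind => n u t; rewrite subr0 hSE /= iotaE PhiE.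
    have [F FP] := selectable_sub u.
    have [e _ [Ge Ve]] := FP _ (set_mem (valP t)).
    rewrite (selected_pointE T i0 hU (z := (t, 1)) Ge Ve) (join_point_end s hU _ 0 Ve).
    by rewrite -(selected_pointE T i0 hU (z := (t, 0)) Ge)//; exact: join_valid_false.
  + elim/realization_ind => n u t; rewrite subrr hSE /=.
    have [F FP] := selectable_sub u.
    have [e _ [Ge Ve]] := FP _ (set_mem (valP t)).
    rewrite (selected_pointE T i0 hU (z := (t, 0)) Ge Ve) (join_point_start s hU _ Ve).
    by apply: sub_classE; rewrite jump_lift.
- exists (fun q => hK (q.1, 1 - q.2)); split.
  + apply: continuous_subspaceT => q; apply: continuous_comp; [exact: rev_c|exact: hK_c].
  + elim/realization_ind => n g t; rewrite subr0 hKE /= PhiE.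
    have [F FP] := selU n (partial_products g).
    have [e _ [Ge Ve]] := FP _ (set_mem (valP t)).
    rewrite (selected_pointE T i0 hN (z := (t, 1)) Ge) // (join_point_end s hN _ 0)//.
    rewrite (selected_pointE T i0 hU (z := (t, 0)) Ge)// /join_point.
    rewrite (sub_classE _ (u := sub_simplex Ve))// iotaE /nerve_class.
    (* The projected vertices lie in one coset of H_i, so their jumps lie in H_i, where [lam] undoes
       [pi]. *)
    suff -> : lift_simplex (sub_simplex Ve) =
      jump (block_seq (join_key A H false e) (partial_products g)) by [].
    apply/ffunP => k; rewrite ffunE.
    have [Hk e'] := sub_valid_coset (join_key_false e (partial_products g)) k.
    by rewrite -[RHS](lamK Hk) -e'.
  + elim/realization_ind => n g t; rewrite subrr hKE /=.
    have [F FP] := selN true n (partial_products g).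
    have [e _ [Ge Ve]] := FP _ (set_mem (valP t)).
    rewrite (selected_pointE T i0 hN (z := (t, 0)) Ge Ve) (join_point_start s hN _ Ve).
    by rewrite /nerve_class jump_partial_products.
Qed.

End Whitehead.

(** * Normal forms in amalgamated products *)

Section Permutations.
Variable W : Type.

Record permutation := Permutation {
  perm_fun :> W -> W;
  perm_inv : W -> W;
  perm_funK : cancel perm_fun perm_inv;
  perm_invK : cancel perm_inv perm_fun
}.

HB.instance Definition _ := gen_eqMixin permutation.
HB.instance Definition _ := gen_choiceMixin permutation.

Lemma permutation_ext (u v : permutation) : u =1 v -> u = v.
Proof.
case: u v => [f f' fK f'K] [g g' gK g'K] /= /funext fg.
have f'g' : f' = g' by apply/funext => x; rewrite -{1}[x]g'K -fg fK.
by subst g g'; congr Permutation; apply: Prop_irrelevance.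
Qed.

Definition permutation_mul (u v : permutation) :=
  Permutation (can_comp (perm_funK u) (perm_funK v)) (can_comp (perm_invK v) (perm_invK u)).
Definition permutation_one := @Permutation id id (fun=> erefl) (fun=> erefl).
Definition permutation_inv (u : permutation) := Permutation (perm_invK u) (perm_funK u).

Lemma permutation_mulA : associative permutation_mul.
Proof. by move=> u v w; apply: permutation_ext. Qed.
Lemma permutation_mul1 : left_id permutation_one permutation_mul.
Proof. by move=> u; apply: permutation_ext. Qed.
Lemma permutation_mulr1 : right_id permutation_one permutation_mul.
Proof. by move=> u; apply: permutation_ext. Qed.
Lemma permutation_mulV : left_inverse permutation_one permutation_inv permutation_mul.
Proof. by move=> u; apply: permutation_ext => x; exact: perm_funK. Qed.
Lemma permutation_mulVr : right_inverse permutation_one permutation_inv permutation_mul.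
Proof. by move=> u; apply: permutation_ext => x; exact: perm_invK. Qed.

HB.instance Definition _ := isGroup.Build permutation permutation_mulA
  permutation_mul1 permutation_mulr1 permutation_mulV permutation_mulVr.

Lemma permutationM (u v : permutation) x : (u * v)%g x = u (v x).
Proof. by []. Qed.

End Permutations.

Section NormalForms.
Local Open Scope group_scope.
Variables (G : groupType) (I : choiceType) (A : set G) (H : I -> set G).
Hypothesis A1 : A 1.
Hypothesis AM : forall {a b}, A a -> A b -> A (a * b).
Hypothesis AV : forall {a}, A a -> A a^-1.
Hypothesis AH : forall {i a}, A a -> H i a.
Hypothesis HM : forall {i a b}, H i a -> H i b -> H i (a * b).

Definition coset_rep (g : G) : G := xget 1 [set k | A (k * g^-1)].

Lemma coset_repP g : A (coset_rep g * g^-1).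
Proof. by rewrite /coset_rep; case: xgetP => [k _ //|/(_ g)[]]; rewrite /= mulgV. Qed.

Lemma coset_rep_mul a g : A a -> coset_rep (a * g) = coset_rep g.
Proof.
move=> Aa; congr (xget _ _); apply/seteqP; split=> k /=; rewrite invgM mulgA.
  by move=> /AM/(_ Aa); rewrite mulgVK.
by move=> kA; apply: AM => //; apply: AV.
Qed.

Lemma coset_repE g : exists2 a, A a & coset_rep g = a * g.
Proof. by exists (coset_rep g * g^-1); [exact: coset_repP|rewrite mulgVK]. Qed.

Notation word := (G * seq (I * G))%type.

Definition head_not i (l : seq (I * G)) : Prop :=
  if l is (j, _) :: _ then j <> i else True.

Fixpoint reduced (l : seq (I * G)) : Prop :=
  if l is (i, g) :: l' then
    [/\ H i g, ~ A g, coset_rep g = g, head_not i l' & reduced l']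
  else True.

(* (a, [:: (i_1, g_1); ...; (i_n, g_n)]) stands for the element a g_1 ... g_n of the
   amalgam. *)
Definition normal_form (w : word) : Prop := A w.1 /\ reduced w.2.

Definition split_head i (w : word) : word :=
  if w.2 is (j, g) :: l then if j == i then (w.1 * g, l) else w else w.

Definition merge_head i (w : word) : word :=
  if `[< A w.1 >] then w
  else (w.1 * (coset_rep w.1)^-1, (i, coset_rep w.1) :: w.2).

(** Van der Waerden's method: splitting and merging are inverse bijections between normal forms and
    pairs of a head in H_i and a rest not starting in H_i. Left multiplication of the head is an
    action of H_i. *)
Definition word_act i (h : G) (w : word) : word :=
  merge_head i (h * (split_head i w).1, (split_head i w).2).

Definition head_split i (w : word) := [/\ H i w.1, head_not i w.2 & reduced w.2].

Lemma split_headP i w : normal_form w -> head_split i (split_head i w).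
Proof.
case: w => a [|[j g] l] [/= Aa]; rewrite /split_head /=; [move=> _|move=> [Hg nAg gE lj rl]].
  by split => //; exact: AH.
case: eqP => [e|ji]; first by subst j; split=> //=; exact: HM (AH Aa) Hg.
by split=> //=; exact: AH.
Qed.

Lemma merge_headP i w : head_split i w -> normal_form (merge_head i w).
Proof.
case: w => h l [/= Hh hl rl]; rewrite /merge_head /=; case: asboolP => [Ah|nAh]; first by split.
have [a Aa hE] := coset_repE h; split=> /=.
  by rewrite hE invgM mulgA mulgV mul1g; apply: AV.
split=> //.
- by rewrite hE; exact: HM (AH Aa) Hh.
- by rewrite hE => /(AM (AV Aa)); rewrite mulKg.
- by rewrite [in LHS]hE coset_rep_mul.
Qed.

Lemma merge_headK i w : head_split i w -> split_head i (merge_head i w) = w.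
Proof.
case: w => h l [/= Hh hl rl]; rewrite /merge_head /=; case: asboolP => [Ah|nAh].
  by case: l hl {rl} => [|[j g] l] //= ji; rewrite /split_head /=; case: eqP.
by rewrite /split_head /= eqxx mulgVK.
Qed.

Lemma split_headK i w : normal_form w -> merge_head i (split_head i w) = w.
Proof.
case: w => a [|[j g] l] [/= Aa]; rewrite /split_head /=; [move=> _|move=> [Hg nAg gE lj rl]].
  by rewrite /merge_head asboolT.
case: eqP => [e|ji]; last by rewrite /merge_head asboolT.
subst j; rewrite /merge_head asboolF /=; last first.
  by move=> /(AM (AV Aa)); rewrite mulKg.
by rewrite coset_rep_mul// gE mulgK.
Qed.

Lemma word_actP i h w : H i h -> normal_form w -> normal_form (word_act i h w).
Proof.
move=> Hh /(split_headP i)[h1 h2 h3]; apply: merge_headP; split=> //=; exact: HM.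
Qed.

Lemma word_act1 i w : normal_form w -> word_act i 1 w = w.
Proof.
by move=> nw; rewrite /word_act mul1g -surjective_pairing split_headK.
Qed.

Lemma word_actM i g h w : H i h -> normal_form w ->
  word_act i (g * h) w = word_act i g (word_act i h w).
Proof.
move=> Hh /(split_headP i)[h1 h2 h3]; rewrite {2}/word_act [in RHS]/word_act.
rewrite merge_headK /=; last by split=> //=; exact: HM.
by rewrite /word_act mulgA.
Qed.

(** The result does not depend on [i], so the actions of the factors agree on [A] and define one of
    the amalgam. *)
Lemma word_actA i a w : A a -> normal_form w -> word_act i a w = (a * w.1, w.2).
Proof.
case: w => b [|[j g] l] Aa [/= Ab]; rewrite /word_act /split_head /=;
  [move=> _|move=> [Hg nAg gE lj rl]].
  by rewrite /merge_head asboolT//; exact: AM.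
case: eqP => [e|ji] /=; last by rewrite /merge_head asboolT//=; exact: AM.
subst j; rewrite /merge_head mulgA asboolF /=; last first.
  by move=> /(AM (AV (AM Aa Ab))); rewrite mulKg.
by rewrite coset_rep_mul ?gE ?mulgK//; exact: AM.
Qed.

(** Each letter accounts for two edges of the path from A, and the first letter gives its
    direction. *)
Definition signed_length i (l : seq (I * G)) : int :=
  if l is (j, _) :: _ then
    if j == i then (2 * (size l)%:Z)%R else (- (2 * (size l)%:Z))%R
  else 0%R.

Lemma signed_length_neq i j l : i != j -> (signed_length i l + signed_length j l <= 0)%R.
Proof.
case: l => [|[k g] l] //= ij; case: (eqVneq k i) => [->|ki].
  by rewrite (negbTE ij); lia.
by case: ifP => _; lia.
Qed.

Lemma signed_length_act i h w : H i h -> ~ A h -> normal_form w ->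
  (2 <= signed_length i w.2 + signed_length i (word_act i h w).2)%R.
Proof.
case: w => b l Hh nAh [/= Ab rl]; rewrite /word_act /split_head /=.
have nAhb : ~ A (h * b) by move=> /AM/(_ (AV Ab)); rewrite mulgK.
case: l rl => [_|[j g] l [Hg nAg gE lj rl]] /=.
  by rewrite /merge_head asboolF//= eqxx; lia.
have [ji|ji] := eqVneq j i; last first.
  by rewrite /merge_head asboolF//= eqxx; lia.
(* If the head is absorbed into [A], the remaining word is empty or starts in another factor, so its
   signed length is at most 0. *)
subst j; rewrite /merge_head /=; case: asboolP => _ /=; last by rewrite eqxx; lia.
case: l lj {rl} => [|[k g'] l] /=; first by lia.
by move/eqP/negbTE ->; lia.
Qed.

Definition normal_word := {w : word | `[< normal_form w >]}.

Definition normal_word_act i h (Hh : H i h) (w : normal_word) : normal_word :=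
  exist _ (word_act i h (val w))
    (asboolT (word_actP Hh (asboolW (valP w)))).

Definition empty_word : normal_word :=
  exist (fun w => `[< normal_form w >]) (1, [::]) (asboolT (conj A1 Logic.I)).

End NormalForms.

(** * The signed distance on an amalgam *)

Section AmalgamTree.
Local Open Scope group_scope.
Variables (A0 G : groupType) (I : finType) (G_ : I -> groupType).
Variables (iota : forall i, group_hom A0 (G_ i)) (f : forall i, group_hom (G_ i) G).
Hypothesis fE : forall i j a, f i (iota i a) = f j (iota j a).
Hypothesis f_inj : forall i, injective (f i).
Hypothesis f_cap : forall i j g h, i != j -> f i g = f j h -> exists a, g = iota i a.
Hypothesis G_fin : forall i, exists l : seq (G_ i), forall g, g \in l.
Variable i0 : I.

Notation K := (amalgam iota).

Definition base_image : set K := [set k | exists a, k = amalgam_in iota (iota i0 a)].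
Definition factor_image (i : I) : set K := [set k | exists g, k = amalgam_in iota (g : G_ i)].

(** Letters are recorded by their images in [G], so that words over all factors have one type;
    products are formed only within one factor. *)
Let AG : set G := [set g | exists a, g = f i0 (iota i0 a)].
Let HG (i : I) : set G := [set g | exists h, g = f i h].

Let AG1 : AG 1.
Proof. by exists 1; rewrite !gmulf1. Qed.
Let AGM : forall a b, AG a -> AG b -> AG (a * b).
Proof. by move=> _ _ [a ->] [b ->]; exists (a * b); rewrite !gmulfM. Qed.
Let AGV : forall a, AG a -> AG a^-1.
Proof. by move=> _ [a ->]; exists a^-1; rewrite !gmulfV. Qed.
Let AGH : forall i a, AG a -> HG i a.
Proof. by move=> i _ [a ->]; exists (iota i a); exact: fE. Qed.
Let HGM : forall i a b, HG i a -> HG i b -> HG i (a * b).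
Proof. by move=> i _ _ [a ->] [b ->]; exists (a * b); rewrite !gmulfM. Qed.

Let W := normal_word AG HG.

Let act i (g : G_ i) : W -> W :=
  normal_word_act AG1 AGM AGV AGH HGM (ex_intro _ g erefl : HG i (f i g)).

Let nf (w : W) : normal_form AG HG (val w) := asboolW (valP w).

Let act1 i w : act (1 : G_ i) w = w.
Proof. by apply: val_inj; rewrite /= gmulf1 (word_act1 AGM AGV i (nf w)). Qed.

Let actM i (g h : G_ i) w : act (g * h) w = act g (act h w).
Proof.
apply: val_inj; rewrite /= gmulfM.
by rewrite (word_actM AGH HGM _ (ex_intro _ h erefl : HG i (f i h)) (nf w)).
Qed.

Let actK i (g : G_ i) : cancel (act g) (act g^-1).
Proof. by move=> w; rewrite -actM mulVg act1. Qed.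
Let actKV i (g : G_ i) : cancel (act g^-1) (act g).
Proof. by move=> w; rewrite -actM mulgV act1. Qed.

Let act_perm i (g : G_ i) : permutation W := Permutation (actK g) (actKV g).

Let act_perm_morph i : monoid.monoid_morphism (@act_perm i).
Proof.
split=> [|g h]; apply: permutation_ext => w; first exact: act1.
exact: actM.
Qed.

Let act_hom i : group_hom (G_ i) (permutation W) :=
  HB.pack (@act_perm i)
    (isUMagmaMorphism.Build (G_ i) (permutation W) (@act_perm i) (@act_perm_morph i)).

Let act_iota i a w : val (act (iota i a) w) = (f i0 (iota i0 a) * (val w).1, (val w).2).
Proof.
have AGa : AG (f i0 (iota i0 a)) by exists a.
by rewrite /= (fE i i0) (word_actA AGM AGV i AGa (nf w)).
Qed.

Let act_homE i j a : act_hom i (iota i a) = act_hom j (iota j a).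
Proof. by apply: permutation_ext => w; apply: val_inj; rewrite [LHS]act_iota [RHS]act_iota. Qed.

Lemma amalgam_gen (P : K -> Prop) : P 1 ->
  (forall g i h, P g -> factor_image i h -> P (g * h)) -> forall g, P g.
Proof.
move=> P1 PM; elim/cosetW; elim/free_classW; elim/last_ind => [//|w [x b] IH].
have -> : free_class (rcons w (x, b)) = free_class w * free_class [:: (x, b)].
  by rewrite -cats1 [RHS]free_mulE.
rewrite cosetM; apply: (PM _ (tag x)) => //.
case: b; last by exists (tagged x); case: x.
exists (tagged x)^-1; rewrite gmulfV -[RHS]/((coset _ _)^-1) -gmulfV; congr (coset _ _).
by case: x => i g; rewrite [RHS]free_invE.
Qed.

Lemma amalgam_tree : exists s, tree_structure base_image factor_image s.
Proof.
have [phi phiE] := amalgam_lift act_homE.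
pose w0 : W := empty_word _ AG1.
(* Acting on the empty word reads off the normal form of [k]. *)
pose s i k : int := signed_length i (val (phi k w0)).2.
exists s; split.
- by exists 1; rewrite !gmulf1.
- by move=> _ _ [a ->] [b ->]; exists (a * b); rewrite !gmulfM.
- by move=> _ [a ->]; exists a^-1; rewrite !gmulfV.
- by move=> i _ [a ->]; exists (iota i a); exact: amalgam_in_iota.
- by move=> i _ _ [a ->] [b ->]; exists (a * b); rewrite !gmulfM.
- by move=> i _ [a ->]; exists a^-1; rewrite !gmulfV.
- exact: amalgam_gen.
- pose l i := sval (cid (G_fin i)).
  have lP i g : g \in l i := svalP (cid (G_fin i)) g.
  exists (flatten [seq [seq amalgam_in iota g | g <- l i] | i <- enum I]) => i _ [g ->].
  apply/flattenP; exists [seq amalgam_in iota g | g <- l i].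
    by apply/mapP; exists i; rewrite ?mem_enum.
  by apply/mapP; exists g.
- by move=> i; rewrite /s gmulf1.
- move=> i _ k [a ->]; rewrite /s gmulfM phiE permutationM.
  by rewrite [act_hom _ _ _]/(act _ _) act_iota.
- by move=> i j k; exact: signed_length_neq.
- move=> i _ k [g ->] nA; rewrite /s gmulfM phiE permutationM.
  apply: (signed_length_act AGM AGV _ _ (nf _)); first by exists g.
  move=> [a]; rewrite (fE i0 i) => /f_inj ga; apply: nA.
  by exists a; rewrite ga; exact: amalgam_in_iota.
Qed.

Section SubNerve.
Variables (R : realType) (P : forall n, pred (nerve G n)).
Hypothesis Pact : forall m n (f : ordmap m n) (x : nerve G n), P x -> P (sact f x).
Hypothesis PE : forall n (g : nerve G n),
  P g <-> exists i, forall k, exists h, g k = f i h.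

(* Whitehead's theorem on unions of aspherical spaces, for the nerves of the G_i. *)
Theorem amalgam_homotopy_equivalent :
  homotopy_equivalent R (realization R (sub_sset Pact)) (classifying_space R (amalgam iota)).
Proof.
have [s T] := amalgam_tree; have [pi piE] := amalgam_lift fE.
pose lam g : K := xget 1 [set k | exists i (h : G_ i), k = amalgam_in iota h /\ g = f i h].
apply: (@sub_nerve_homotopy_equivalent R K G I _ _ s T i0 pi lam).
- move=> i _ [h ->]; rewrite piE /lam.
  case: xgetP => [k _ [j [h' [-> e]]]|/(_ (amalgam_in iota h))[]]; last by exists i, h.
  have [ij|ij] := eqVneq i j; first by subst j; rewrite (f_inj e).
  have [a ha] := f_cap ij e; rewrite ha (amalgam_in_iota _ i j).
  by congr amalgam_in; apply: (@f_inj j); rewrite -e ha.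
- move=> n g; rewrite PE; split=> -[i gi]; exists i => k.
    have [h gk] := gi k; exists (amalgam_in iota h); first by exists h.
    by rewrite piE.
  by have [_ [h ->] gk] := gi k; exists h; rewrite gk piE.
Qed.

End SubNerve.
End AmalgamTree.

(** * Generalized quaternion groups *)

Section Quaternion.
Local Open Scope complex_scope.
Local Open Scope group_scope.
Variables (R : realType) (q : nat).

Notation w := (SU2_w R).
Notation rot := Defs.rot.

Definition rho : SU2 R := rot (2 * pi / (2 ^ q)%:R)%R.

Lemma rhoX k : rho ^+ k = rot (2 * pi / (2 ^ q)%:R *+ k)%R.
Proof. exact: rotX. Qed.

Lemma rho_order : rho ^+ (2 ^ q) = 1.
Proof.
rewrite rhoX -mulr_natr mulrVK ?unitfE ?pnatr_eq0 ?expn_eq0//.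
have c1 : cis (2 * pi) = 1%R :> R[i] by rewrite /cis mulr_natl cos2pi sin2pi.
have c2 := cistN (2 * pi : R)%R; rewrite c1 mulr1 in c2.
by apply: val_inj; rewrite /= c1 c2 mx22_1.
Qed.

Lemma rot_eq1 (t : R) : (0 <= t < 2 * pi)%R -> rot t = 1 -> t = 0%R.
Proof.
move=> /andP[t0 t2] /(congr1 (fun A : SU2 R => complex.Re ((A : 'M_2) ord0 ord0))).
rewrite /= !mxE /= => ct.
apply/eqP/negPn/negP => tn0.
have t0' : (0 < t)%R by rewrite lt_neqAle eq_sym tn0.
have : (0 < sin (t / 2))%R by apply: sin_gt0_pi; rewrite ?divr_gt0//=; lra.
have tE : t = (t / 2 *+ 2)%R by rewrite -mulr_natr divfK// pnatr_eq0.
by move: ct; rewrite tE cos_mulr2n cos2sin2 -tE => ct; nra.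
Qed.

Lemma rho_eq1 k : rho ^+ k = 1 -> (2 ^ q %| k)%N.
Proof.
move=> rk; rewrite /dvdn; have q0 : (0 < 2 ^ q)%N by rewrite expn_gt0.
have : rho ^+ (k %% 2 ^ q) = 1.
  by rewrite -rk [in RHS](divn_eq k (2 ^ q)) expgnDr mulnC expgnA rho_order expg1n mul1g.
rewrite rhoX => /rot_eq1; rewrite -mulr_natr mulrAC => h.
have q0R : (0 < (2 ^ q)%:R :> R)%R by rewrite ltr0n.
have lt2pi : (0 <= 2 * (pi : R) * (k %% 2 ^ q)%:R / (2 ^ q)%:R < 2 * (pi : R))%R.
  rewrite divr_ge0 ?mulr_ge0 ?pi_ge0//= ltr_pdivrMr// ltr_pM2l; last first.
    by rewrite mulr_gt0 ?pi_gt0.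
  by rewrite ltr_nat ltn_mod.
have /eqP := h lt2pi.
rewrite !mulf_eq0 invr_eq0 !pnatr_eq0 (gt_eqF (pi_gt0 R)) (gtn_eqF q0) /=.
by rewrite orbF.
Qed.

Lemma rho_mod k : rho ^+ (k %% 2 ^ q) = rho ^+ k.
Proof. by rewrite [in RHS](divn_eq k (2 ^ q)) expgnDr mulnC expgnA rho_order expg1n mul1g. Qed.

Lemma rho_eq k l : rho ^+ k = rho ^+ l -> k = l %[mod 2 ^ q].
Proof.
wlog kl : k l / (k <= l)%N.
  by move=> h; case/orP: (leq_total k l) => [/h//|/h h' /esym/h' ->].
move=> e; apply/esym/eqP; rewrite eqn_mod_dvd//; apply: rho_eq1.
by rewrite expgnFr// e mulgV.
Qed.

Lemma rhoV k : (rho ^+ k)^-1 = rho ^+ (k * (2 ^ q).-1).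
Proof.
apply: (mulgI (rho ^+ k)); rewrite mulgV -expgnDr -mulnS prednK ?expn_gt0//.
by rewrite mulnC expgnA rho_order expg1n.
Qed.

Lemma mu_rhoP b A : (b <= q)%N -> A \in mu R (2 ^ b) <-> exists k, A = rho ^+ (2 ^ (q - b) * k).
Proof.
move=> bq.
have rbE : rot (2 * pi / (2 ^ b)%:R)%R = rho ^+ (2 ^ (q - b)).
  rewrite rhoX; congr (rot _).
  rewrite -[RHS]mulr_natr -[in RHS](subnK bq) expnD natrM invfM.
  rewrite addnK [((2 ^ (q - b))%:R^-1 * _)%R]mulrC.
  by rewrite -!mulrA mulVf ?mulr1// pnatr_eq0 expn_eq0.
split=> [/generatedP|[k ->]]; last by rewrite expgnA -rbE gpredXn// mem_generated.
elim=> {A} [_ ->||_ _ _ [k ->] _ [l ->]|_ _ [k ->]].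
- by exists 1%N; rewrite muln1.
- by exists 0%N; rewrite muln0.
- by exists (k + l)%N; rewrite mulnDr expgnDr.
- by exists (k * (2 ^ q).-1)%N; rewrite rhoV mulnA.
Qed.

(** Conjugation by [rho] shifts the exponent in [w * rho ^+ k] by 2. Its square root [half_rho],
    outside Q_(2^(q+1)), shifts it by 1 and so reaches all copies of Q_(2^r), which are not all
    conjugate inside Q_(2^(q+1)). *)
Definition half_rho : SU2 R := rot (pi / (2 ^ q)%:R)%R.

Lemma half_rho_sq : half_rho * half_rho = rho.
Proof. by rewrite -Defs.rotD; congr (rot _); rewrite -mulrDl -mulr2n mulr_natl. Qed.

Lemma rot_comm (t u : R) : rot t * rot u = rot u * rot t.
Proof. by rewrite -!Defs.rotD addrC. Qed.

Lemma rotXw t k : (rot t ^+ k)^-1 * w = w * rot t ^+ k.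
Proof.
rewrite rotX; set u := (t *+ k)%R; apply: (mulgI w^-1).
by rewrite mulKg -rotN mulgA rot_w rotN invgK.
Qed.

Lemma rhoXw k l : (w * rho ^+ k) ^ (half_rho ^+ l) = w * rho ^+ (l + k).
Proof.
have e : commute (half_rho ^+ l) (rho ^+ k) by apply: commuteX2; exact: rot_comm.
rewrite /conjg !mulgA rotXw -!mulgA; congr (_ * _).
rewrite -e mulgA expgnDr -expgMn ?half_rho_sq//; exact: rot_comm.
Qed.

Lemma rhoXJ k l : (rho ^+ k) ^ (half_rho ^+ l) = rho ^+ k.
Proof.
have e : commute (half_rho ^+ l) (rho ^+ k) by apply: commuteX2; exact: rot_comm.
by rewrite /conjg -e mulKg.
Qed.

Lemma w_rhoX_neq k l : w * rho ^+ k <> rho ^+ l.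
Proof.
rewrite !rhoX => /(congr1 (fun A : SU2 R => (A : 'M_2) ord0 ord0)).
rewrite /= mx22M !mxE /= !mul0r mulr0 add0r => /esym c0.
have := cisNt (2 * pi / (2 ^ q)%:R *+ l : R)%R.
by rewrite c0 mul0r => /eqP; rewrite eq_sym oner_eq0.
Qed.

Lemma mu_full k : rho ^+ k \in mu R (2 ^ q).
Proof. by apply/mu_rhoP => //; exists k; rewrite subnn mul1n. Qed.

Lemma commg_rhoX_w k l : [~ rho ^+ k, w * rho ^+ l] = (rho ^+ (k * 2))^-1.
Proof.
have e : (rho ^+ k) ^ w = (rho ^+ k)^-1 by rewrite rhoX /conjg mulgA rot_w.
rewrite commgEl conjgM e conjVg (_ : (rho ^+ k) ^ (rho ^+ l) = rho ^+ k); last first.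
  by rewrite /conjg (commuteX2 k l (commute_refl rho)) mulKg.
by rewrite -invgM -expgnDr muln2 addnn.
Qed.

Lemma mu_sub_full b A : (b <= q)%N -> A \in mu R (2 ^ b) -> exists k, A = rho ^+ k.
Proof. by move=> bq /(mu_rhoP _ bq)[k ->]; eexists. Qed.

Lemma mu_commute a b A B : (a <= q)%N -> (b <= q)%N ->
  A \in mu R (2 ^ a) -> B \in mu R (2 ^ b) -> [~ A, B] = 1.
Proof.
move=> aq bq /(mu_sub_full aq)[k ->] /(mu_sub_full bq)[l ->].
by apply/eqP/commgP/commuteX2.
Qed.

Lemma commg_mu_w b A l : (b < q)%N -> A \in mu R (2 ^ b.+1) ->
  [~ A, w * rho ^+ l] \in mu R (2 ^ b).
Proof.
move=> bq /(mu_rhoP _ bq)[k ->]; rewrite commg_rhoX_w gpredV.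
apply/(mu_rhoP _ (ltnW bq)); exists k; congr (_ ^+ _).
by rewrite -(subnSK bq) expnS; lia.
Qed.

(** On powers of [rho], the commutator with [w * rho ^+ l] is the inverse of squaring, so [m]
    iterations kill only the elements of order dividing 2^m. *)
Lemma iter_commg_w m A l : (m <= q)%N -> A \in mu R (2 ^ q) ->
  iter m (fun u => [~ u, w * rho ^+ l]) A = 1 -> A \in mu R (2 ^ m).
Proof.
elim: m A => [|m IH] A mq Aq; first by move=> /= ->; exact: gpred1.
have [k Ak] := mu_sub_full (leqnn q) Aq.
rewrite iterSr Ak commg_rhoX_w => /(IH _ (ltnW mq)).
rewrite gpredV => /(_ _); rewrite gpredV mu_full => /(_ isT).
case/(mu_rhoP _ (ltnW mq)) => j /rho_eq e.
have : (2 ^ (q - m) %| k * 2)%N.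
  rewrite /dvdn -(@modn_dvdm (2 ^ q)) ?e ?modn_dvdm ?modnMr//.
    by rewrite dvdn_exp2l// leq_subr.
  by rewrite dvdn_exp2l// leq_subr.
rewrite -(subnSK mq) expnSr dvdn_pmul2r// => /dvdnP[j' ->].
by apply/(mu_rhoP _ mq); exists j'; rewrite mulnC.
Qed.

Lemma Q2_rhoP r (hr : (2 <= r)%N) A : (r <= q.+1)%N ->
  A \in (Q2 R r hr) <->
  exists k, A = rho ^+ (2 ^ (q.+1 - r) * k) \/ A = w * rho ^+ (2 ^ (q.+1 - r) * k).
Proof.
move=> rq; have rq' : (r - 1 <= q)%N by lia.
have e : (q - (r - 1) = q.+1 - r)%N by lia.
split=> [/asboolP[/(mu_rhoP _ rq')[k ->]|[_ /(mu_rhoP _ rq')[k ->] ->]]|[k kA]].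
- by exists k; left; rewrite e.
- by exists k; right; rewrite e.
apply/asboolP; case: kA => ->.
  by left; apply/(mu_rhoP _ rq'); exists k; rewrite e.
right; exists (rho ^+ (2 ^ (q.+1 - r) * k)) => //.
by apply/(mu_rhoP _ rq'); exists k; rewrite e.
Qed.

End Quaternion.

(** * Lower central series and nilpotent tuples *)

Section NilpotentHom.
Local Open Scope group_scope.

Lemma lower_central_filtration (G : groupType) (S : nat -> G -> Prop) :
  (forall x, S 0 x) -> (forall k, S k 1) ->
  (forall k x y, S k x -> S k y -> S k (x * y)) ->
  (forall k x, S k x -> S k x^-1) ->
  (forall k x y, S k x -> S k.+1 [~ x, y]) ->
  forall k x, x \in lower_central G k.+1 -> S k x.
Proof.
move=> S0 S1 SM SV SR; elim=> [//|k IH] x.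
rewrite lower_centralS// => /generatedP; elim=> {x}.
- by move=> _ [a [b [/IH ak _ ->]]]; exact: SR.
- exact: S1.
- by move=> x y _ Sx _ Sy; exact: SM.
- by move=> x _; exact: SV.
Qed.

Lemma iter_commg_lower_central (G : groupType) m (x y : G) :
  iter m (fun u => [~ u, y]) x \in lower_central G m.+1.
Proof.
elim: m => [//|m IH]; rewrite lower_centralS//=; apply: mem_generated.
by exists (iter m (fun u => [~ u, y]) x), y.
Qed.

Lemma gmulf_iter_commg (G H : groupType) (f : group_hom G H) m (x y : G) :
  iter m (fun u => [~ u, f y]) (f x) = f (iter m (fun u => [~ u, y]) x).
Proof. by elim: m => //= m ->; rewrite gmulfR. Qed.

Lemma is_nilpotent_hom_comp (G H : groupType) (f : group_hom H G) r n
    (g : {ffun 'I_n -> G}) (h : 'I_n -> H) :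
  (forall x, x \in lower_central H r -> x = 1) -> (forall k, g k = f (h k)) ->
  is_nilpotent_hom r g.
Proof.
move=> Hr gE; apply/asboolP.
have FN x : x \in lower_central (free_group 'I_n) r -> free_lift_hom h x = 1.
  by move=> /(lower_central_hom (free_lift_hom h))/Hr.
exists (f \o quot_lift_hom FN : group_hom _ _) => k.
rewrite gE; congr (f _); apply: etrans (quot_liftE FN _) _.
exact: free_lift_gen.
Qed.

(** Stated on the whole free group, the vanishing also applies to words in the entries, such as the
    quotient of two of them. *)
Lemma is_nilpotent_hom_iter (G : groupType) r n (g : {ffun 'I_n -> G}) : 0 < r ->
  is_nilpotent_hom r g -> exists ev : group_hom (free_group 'I_n) G,
    (forall k, ev (free_gen k) = g k) /\
    forall x y, iter r.-1 (fun u => [~ u, ev y]) (ev x) = 1.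
Proof.
move=> r0 /asboolP[phi phiE].
pose N := lower_central (free_group 'I_n) r.
exists (phi \o coset N : group_hom _ _); split=> [k|x y]; first exact: phiE.
set ev := (phi \o coset N : group_hom _ _).
have -> : iter r.-1 (fun u => [~ u, ev y]) (ev x) = ev (iter r.-1 (fun u => [~ u, y]) x).
  exact: gmulf_iter_commg.
have := iter_commg_lower_central r.-1 x y; rewrite prednK// => xN.
transitivity (phi 1); last exact: gmulf1.
congr (phi _); apply/esym/coset_eqP.
by rewrite invg1 mul1g.
Qed.

Section ConjInclusion.
Variables (G : groupType) (S T : groupClosed G) (c : G).
Hypothesis ST : forall x, x \in S -> x ^ c \in T.

Definition conj_incl (x : subgroup S) : subgroup T :=
  exist (fun x => x \in T) (val x ^ c) (ST (valP x)).

Lemma conj_incl_morph : monoid.monoid_morphism conj_incl.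
Proof. by split=> [|x y]; apply: val_inj; rewrite /= ?conj1g ?conjMg. Qed.

Definition conj_incl_hom : group_hom (subgroup S) (subgroup T) :=
  HB.pack conj_incl
    (isUMagmaMorphism.Build (subgroup S) (subgroup T) conj_incl conj_incl_morph).

Lemma conj_incl_inj : injective conj_incl_hom.
Proof. by move=> x y /(congr1 val) /conjg_inj/val_inj. Qed.

End ConjInclusion.

Lemma subgroup_finite (G : groupType) (S : groupClosed G) (l : seq G) :
  (forall x, x \in S -> x \in l) ->
  exists l' : seq (subgroup S), forall x, x \in l'.
Proof.
by move=> Sl; exists (pmap insub l) => x; rewrite mem_pmap_sub; apply/Sl/valP.
Qed.

End NilpotentHom.

(** * The factors as subgroups of Q_(2^(q+1)) *)

Section QuaternionAmalgam.
Local Open Scope group_scope.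
Variables (R : realType) (q r : nat) (hq : 2 <= q) (hr : 2 <= r) (hrq : r <= q).

Notation w := (SU2_w R).
Notation rho := (rho R q).
Notation half_rho := (half_rho R q).
Notation N := (2 ^ (q.+1 - r))%N.
Notation Qq := (Q2 R q.+1 (leqW hq)).
Notation factor := (@Q_mu_factor R q r hr).

Lemma mu0 A : A \in mu R (2 ^ 0) -> A = 1.
Proof. by move=> /(mu_rhoP _ (leq0n q))[k ->]; rewrite subn0 expgnA rho_order expg1n. Qed.

Lemma mem_Qq A : A \in Qq <-> exists k, A = rho ^+ k \/ A = w * rho ^+ k.
Proof.
have h := Q2_rhoP (leqW hq) A (leqnn q.+1); rewrite subnn expn0 in h.
by split=> [/h[k]|[k kA]]; [rewrite mul1n|apply/h]; exists k; rewrite ?mul1n.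
Qed.

Lemma conj_Q2 k A : A \in Q2 R r hr -> A ^ (half_rho ^+ k) \in Qq.
Proof.
move=> /(Q2_rhoP hr A (leqW hrq))[l [->|->]].
  by apply/mem_Qq; exists (N * l)%N; left; rewrite rhoXJ.
by apply/mem_Qq; exists (k + N * l)%N; right; rewrite rhoXw.
Qed.

Lemma conj_mu A : A \in mu R (2 ^ q) -> A ^ (half_rho ^+ 0) \in Qq.
Proof.
move=> /(mu_sub_full (leqnn q))[k ->]; rewrite expg0 conjg1.
by apply/mem_Qq; exists k; left.
Qed.

Definition Q_mu_embedding (i : option 'I_N) : group_hom (factor i) (subgroup Qq) :=
  match i with
  | Some k => conj_incl_hom (conj_Q2 k)
  | None => conj_incl_hom conj_mu
  end.

Lemma Q_mu_embedding_inj i : injective (Q_mu_embedding i).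
Proof. by case: i => [k|]; exact: conj_incl_inj. Qed.

Let rq : r - 1 <= q. Proof. by lia. Qed.

Lemma rhoX_mu k : rho ^+ (N * k) \in mu R (2 ^ (r - 1)).
Proof.
by apply/(mu_rhoP _ rq); exists k; congr (_ ^+ (2 ^ _ * _)); lia.
Qed.

Lemma mu_r A : A \in mu R (2 ^ (r - 1)) -> exists k, A = rho ^+ (N * k).
Proof.
move=> /(mu_rhoP _ rq)[k ->].
by exists k; congr (_ ^+ (2 ^ _ * _)); lia.
Qed.

Lemma val_Q_mu_embedding_incl i (a : subgroup (mu R (2 ^ (r - 1)))) :
  val (Q_mu_embedding i (Q_mu_incl R hr hrq i a)) = val a.
Proof.
case: i => [k|] /=; last by rewrite conjg1.
by have [l ->] := mu_r (valP a); rewrite rhoXJ.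
Qed.

(** Outside mu_(2^(r-1)), the residue modulo N of the exponent after [w] determines the copy of
    Q_(2^r); hence the factors meet only in mu_(2^(r-1)). *)
Lemma factorP i (g : factor i) :
  (exists a, g = Q_mu_incl R hr hrq i a) \/
  if i is Some k then exists l, val (Q_mu_embedding i g) = w * rho ^+ (k + N * l)
  else exists l, val (Q_mu_embedding i g) = rho ^+ l.
Proof.
case: i g => [k|] g; last first.
  right; have [l gl] := mu_sub_full (leqnn q) (valP g); exists l.
  by rewrite /= conjg1.
have [l [gl|gl]] := (Q2_rhoP hr (val g) (leqW hrq)).1 (valP g).
  left; exists (exist (fun x => x \in mu R (2 ^ (r - 1))) _ (rhoX_mu l)).
  exact: val_inj.
by right; exists l; rewrite /= [val g]gl rhoXw.
Qed.

Lemma Q_mu_embedding_cap i j (g : factor i) (h : factor j) : i != j ->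
  Q_mu_embedding i g = Q_mu_embedding j h -> exists a, g = Q_mu_incl R hr hrq i a.
Proof.
move=> ij /(congr1 val) e.
case: (factorP g) => [//|gi]; case: (factorP h) => [[a hE]|hj].
  exists a; apply: Q_mu_embedding_inj; apply: val_inj.
  by rewrite e hE !val_Q_mu_embedding_incl.
exfalso; case: i j g h ij e gi hj => [k|] [l|] g h //= kl -> [m ->] [m' /esym].
- move=> /mulgI/rho_eq e; case/negP: kl; apply/eqP; congr Some; apply: val_inj => /=.
  have Nq : N %| 2 ^ q by rewrite dvdn_exp2l//; lia.
  have := congr1 (modn^~ N) e; rewrite !modn_dvdm// !(addnC _ (N * _)%N) !(mulnC N).
  by rewrite !modnMDl !modn_small// => ->.
- by move=> h'; apply: (@w_rhoX_neq R q (k + N * m) m').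
- by move=> h'; apply: (@w_rhoX_neq R q (l + N * m') m).
Qed.

Lemma commg_mu_Qq b A B : b <= q -> A \in mu R (2 ^ b) -> B \in Qq ->
  [~ A, B] \in mu R (2 ^ b.-1).
Proof.
move=> bq Ab /mem_Qq[l [->|->]].
  by rewrite (mu_commute bq (leqnn q) Ab (mu_full R q l)) gpred1.
case: b bq Ab => [|b] bq Ab; last exact: commg_mu_w.
by rewrite (mu0 Ab) comm1g gpred1.
Qed.

Lemma commg_Q2 A B : A \in Q2 R r hr -> B \in Q2 R r hr ->
  [~ A, B] \in mu R (2 ^ (r - 1).-1).
Proof.
have Q2q C : C \in Q2 R r hr -> C \in Qq.
  by move=> /(conj_Q2 0); rewrite expg0 conjg1.
move=> hA hB; have [k [Ak|Ak]] := (Q2_rhoP hr A (leqW hrq)).1 hA.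
  by apply: commg_mu_Qq (Q2q _ hB) => //; rewrite Ak rhoX_mu.
have [l [Bl|Bl]] := (Q2_rhoP hr B (leqW hrq)).1 hB.
  rewrite -invgR gpredV; apply: commg_mu_Qq (Q2q _ hA) => //.
  by rewrite Bl rhoX_mu.
(* [A] commutes with itself, and [A^-1 * B] lies in mu_(2^(r-1)), which reduces to the previous
   case. *)
have -> : [~ A, B] = [~ A, A^-1 * B].
  have AA : A ^ A = A by rewrite conjgE mulKg.
  by rewrite -{1}[B](mulVKg A) !commgEl conjgM AA.
rewrite -invgR gpredV; apply: commg_mu_Qq (Q2q _ hA) => //.
rewrite Ak Bl invgM -mulgA mulKg gpredM ?gpredV ?rhoX_mu//.
Qed.

(** First commutators lie in mu_(2^(r-2)) and each further one halves the order. The disjunct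
    [m = 0] covers the whole group, which lies in no mu. *)
Lemma Q2_lower_central m (x : subgroup (Q2 R r hr)) :
  x \in lower_central _ m.+1 -> m = 0 \/ val x \in mu R (2 ^ (r - m.+1)).
Proof.
move: m x.
apply: (@lower_central_filtration _ (fun m x => m = 0 \/ val x \in mu R (2 ^ (r - m.+1)))).
- by left.
- by right; exact: gpred1.
- by move=> m x y [->|hx] [e|hy]; [left|left|left|right; exact: gpredM].
- by move=> m x [->|hx]; [left|right; exact: gpredVr].
- move=> m x y hx; right; have -> : val [~ x, y] = [~ val x, val y] by [].
  case: m hx => [_|m [//|hx]].
    have -> : r - 2 = (r - 1).-1 by lia.
    by apply: commg_Q2; exact: valP.
  have -> : r - m.+3 = (r - m.+2).-1 by lia.
  apply: commg_mu_Qq hx _; first by lia.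
  by have := conj_Q2 0 (valP y); rewrite expg0 conjg1.
Qed.

Lemma mu_lower_central m (x : subgroup (mu R (2 ^ q))) :
  x \in lower_central _ m.+1 -> m = 0 \/ x = 1.
Proof.
move: m x; apply: (@lower_central_filtration _ (fun m x => m = 0 \/ x = 1)).
- by left.
- by right.
- by move=> m x y [->|->] [e|->]; [left|left|left|right; rewrite mulg1].
- by move=> m x [->|->]; [left|right; rewrite invg1].
- move=> m x y [_|->]; right; last by rewrite comm1g.
  by apply: val_inj; exact: (mu_commute (leqnn q) (leqnn q) (valP x) (valP y)).
Qed.

Lemma factor_lower_central i (x : factor i) : x \in lower_central (factor i) r -> x = 1.
Proof.
have rE : (r - 1).+1 = r by lia.
case: i x => [k|] x.
  have := @Q2_lower_central (r - 1) x; rewrite rE subnn => h /h[|]; first by lia.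
  by move=> /mu0 x1; exact: val_inj.
by have := @mu_lower_central (r - 1) x; rewrite rE => h /h[|//]; lia.
Qed.

Lemma factor_finite i : exists l : seq (factor i), forall g, g \in l.
Proof.
pose L := [seq rho ^+ k | k <- iota 0 (2 ^ q)] ++ [seq w * rho ^+ k | k <- iota 0 (2 ^ q)].
have Lr k : k %% 2 ^ q \in iota 0 (2 ^ q) by rewrite mem_iota /= ltn_mod expn_gt0.
have L1 k : rho ^+ k \in L.
  by rewrite mem_cat; apply/orP; left; apply/mapP; exists (k %% 2 ^ q)%N; rewrite ?rho_mod.
have L2 k : w * rho ^+ k \in L.
  by rewrite mem_cat; apply/orP; right; apply/mapP; exists (k %% 2 ^ q)%N; rewrite ?rho_mod.
case: i => [k|]; apply: (@subgroup_finite _ _ L) => x.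
  by move=> /(Q2_rhoP hr x (leqW hrq))[l [->|->]].
by move=> /(mu_sub_full (leqnn q))[l ->].
Qed.

Lemma Q2_factorP b (g : subgroup Qq) :
  (val g \in mu R (2 ^ (r - 1)) \/
    exists2 A, A \in mu R (2 ^ (r - 1)) & val g = w * (rho ^+ b * A)) ->
  exists h, g = Q_mu_embedding (Some (Ordinal (ltn_pmod b (expn_gt0 2 (q.+1 - r))))) h.
Proof.
set k := Ordinal _; case=> [gA|[A /mu_r[m ->] gA]].
  exists (Q_mu_incl R hr hrq (Some k) (exist (fun x => x \in mu R (2 ^ (r - 1))) _ gA)).
  by apply: val_inj; rewrite val_Q_mu_embedding_incl.
have hB : w * rho ^+ (N * (b %/ N + m)) \in Q2 R r hr.
  by apply/(Q2_rhoP hr _ (leqW hrq)); exists (b %/ N + m)%N; right.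
exists (exist (fun x => x \in Q2 R r hr) _ hB); apply: val_inj.
rewrite /= rhoXw gA -expgnDr; congr (_ * _ ^+ _).
by rewrite {1}(divn_eq b N); lia.
Qed.

(** If some entry is [w * rho ^+ b], then by [iter_commg_w] all rotations in the generated subgroup
    lie in mu_(2^(r-1)). The other entries are such rotations or differ from that entry by one, so
    all lie in the copy of index b modulo N. Otherwise all entries lie in mu_(2^q). *)
Lemma Q2_is_nilpotent_hom n (g : nerve (subgroup Qq) n) :
  is_nilpotent_hom r g <-> exists i, forall k, exists h, g k = Q_mu_embedding i h.
Proof.
split=> [|[i gi]]; last first.
  have [h hE] := choice gi.
  exact: (is_nilpotent_hom_comp (@factor_lower_central i) hE).
case/is_nilpotent_hom_iter => [|ev [evE ev_iter]]; first exact: ltnW.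
have iterE x k b : val (ev x) \in mu R (2 ^ q) -> val (g k) = w * rho ^+ b ->
    val (ev x) \in mu R (2 ^ (r - 1)).
  move=> xq gk; apply: (@iter_commg_w R q (r - 1) _ b rq xq).
  have iter_val m (u v : subgroup Qq) :
      val (iter m (fun u => [~ u, v]) u) = iter m (fun u => [~ u, val v]) (val u).
    by elim: m => //= m ->.
  by rewrite -gk -(evE k) -iter_val subn1 ev_iter.
have gP k := (mem_Qq (val (g k))).1 (valP (g k)).
case: (pselect (exists k b, val (g k) = w * rho ^+ b)) => [[k0 [b g0]]|ng].
  exists (Some (Ordinal (ltn_pmod b (expn_gt0 2 (q.+1 - r))))) => k; apply: Q2_factorP.
  have [l [gl|gl]] := gP k.
    left; rewrite -evE; apply: (iterE _ k0 b) => //.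
    by rewrite evE gl mu_full.
  right; exists ((rho ^+ b)^-1 * rho ^+ l); last by rewrite mulVKg.
  have evx : val (ev ((free_gen k0)^-1 * free_gen k)) = (rho ^+ b)^-1 * rho ^+ l.
    rewrite gmulfM gmulfV !evE.
    transitivity ((val (g k0))^-1 * val (g k)) => //.
    by rewrite g0 gl invgM -mulgA mulKg.
  by rewrite -evx; apply: (iterE _ k0 b) => //; rewrite evx gpredM ?gpredV ?mu_full.
exists None => k; have [l [gl|gl]] := gP k; last by case: ng; exists k, l.
have gm : val (g k) \in mu R (2 ^ q) by rewrite gl mu_full.
exists (exist (fun x => x \in mu R (2 ^ q)) _ gm); apply: val_inj.
by rewrite /= conjg1.
Qed.

End QuaternionAmalgam.

Theorem mainTheorem9 (R : realType) (q r : nat)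
    (hq : 2 <= q) (hr : 2 <= r) (hrq : r <= q) :
  homotopy_equivalent R
    (nilpotent_classifying_space R r (subgroup (Q2 R q.+1 (leqW hq))))
    (classifying_space R (Q_mu_amalgam R hr hrq)).
Proof.
apply: (@amalgam_homotopy_equivalent _ _ _ _ _ (@Q_mu_embedding R q r hq hr hrq)).
- by move=> i j a; apply: val_inj; rewrite !val_Q_mu_embedding_incl.
- exact: Q_mu_embedding_inj.
- exact: Q_mu_embedding_cap.
- exact: factor_finite.
(* The base index, here the factor mu_(2^q), through which the common subgroup is viewed. *)
- exact: None.
- exact: Q2_is_nilpotent_hom.
Qed.
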